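(* Let $d\ge 3$ and let $P\subset\mathbb{R}^d$ be a $d$-dimensional convex lattice polytope with Ehrhart polynomial $\mathrm{G}(kP)=\sum_{i=0}^d \mathrm{g}_i(P)\,k^i$. Then for every $i=1,\dots,d-1$, $$\mathrm{g}_i(P)\ \ge\ \frac{1}{d!}\Big\{(-1)^{d-i}\,\mathrm{stirl}(d+1,i+1)+\big(d!\,\mathrm{vol}(P)-1\big)\,M_{i,d}\Big\}.$$
   Context: A $d$-dimensional convex lattice polytope is a convex polytope $P\subset\mathbb{R}^d$ with $\dim P=d$, all of whose vertices lie in $\mathbb{Z}^d$. For $S\subset\mathbb{R}^d$, $\mathrm{G}(S)=\#(S\cap\mathbb{Z}^d)$. By Ehrhart's theorem, for $k\in\mathbb{N}$, $\mathrm{G}(kP)=\sum_{i=0}^d \mathrm{g}_i(P)k^i$ is a polynomial of degree $d$ in $k$ whose coefficients $\mathrm{g}_i(P)$ depend only on $P$. $\mathrm{vol}$ is the $d$-dimensional Lebesgue measure on $\mathbb{R}^d$. $\mathrm{stirl}(n,j)$ are the (signed) Stirling numbers of the first kind, defined by $\prod_{i=0}^{n-1}(z-i)=\sum_{j=1}^n \mathrm{stirl}(n,j)z^j$. For an integer $i$ and $0\le r\le d$, $C^d_{r,i}$ denotes the coefficient of $z^r$ in the polynomial $(z+i)(z+i-1)\cdots(z+i-(d-1))=d!\binom{z+i}{d}$. For $d\ge3$ and $0\le r\le d$, $M_{r,d}=\min\{C^d_{r,i}:1\le i\le d-2\}$. *)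

(* Defs.v *)
From mathcomp Require Import all_boot all_order all_algebra.
From mathcomp Require Import finmap.
From mathcomp Require Import all_classical all_reals all_analysis.

Set Implicit Arguments.
Unset Strict Implicit.
Unset Printing Implicit Defensive.

Import Order.TTheory GRing.Theory Num.Theory.

Local Open Scope classical_set_scope.
Local Open Scope ring_scope.

Section Polytopes.
Variables (R : realType) (d : nat).
Implicit Types (A P : set 'rV[R]_d) (v x y : 'rV[R]_d).

Definition convex_hull A : set 'rV[R]_d :=
  smallest (@convex_set R 'rV[R]_d) A.

Definition convex_polytope P :=
  exists s : seq 'rV[R]_d, P = convex_hull [set` s].

Definition affine_set A :=
  forall x y (t : R), A x -> A y -> A ((1 - t) *: x + t *: y).

Definition affine_hull A : set 'rV[R]_d := smallest affine_set A.

Definition has_dim A (n : nat) :=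
  exists (x : 'rV[R]_d) (L : {vspace 'rV[R]_d}),
    affine_hull A = [set x + v | v in [set` L]] /\ (\dim L)%VS = n.

(* The vertices of a polytope are its extreme points. *)
Definition vertex P v :=
  P v /\ forall x y (t : R), P x -> P y -> 0 < t < 1 ->
    v = (1 - t) *: x + t *: y -> x = v /\ y = v.

Definition int_points : set 'rV[R]_d :=
  [set x | x \is a mxOver Num.int].

Definition lattice_polytope P :=
  [/\ convex_polytope P, has_dim P d & vertex P `<=` int_points].

(* [fset_set] sends infinite sets to the empty set; only bounded sets, which
   contain finitely many integer points, are considered. *)
Definition nb_int_points A : nat := #|` fset_set (A `&` int_points) |%fset.

Definition dilate (k : nat) P : set 'rV[R]_d := [set k%:R *: x | x in P].

Definition is_ehrhart_poly P (g : {poly R}) :=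
  forall k : nat, (0 < k)%N -> (nb_int_points (dilate k P))%:R = g.[k%:R].

Definition box (a b : 'rV[R]_d) : set 'rV[R]_d :=
  [set x | forall i, a 0 i <= x 0 i <= b 0 i].

(* Lebesgue outer measure: the infimum of the total volume of countable covers
   by boxes. It agrees with Lebesgue measure on all measurable sets. *)
Definition lebesgue_outer A : \bar R :=
  ereal_inf [set v | exists a b : nat -> 'rV[R]_d,
    [/\ forall n i, a n 0 i <= b n 0 i,
        A `<=` \bigcup_n box (a n) (b n) &
        v = (\sum_(0 <= n <oo) (\prod_i (b n 0 i - a n 0 i))%:E)%E]].

(* A polytope is compact, hence measurable and of finite measure. *)
Definition vol P : R := fine (lebesgue_outer P).

End Polytopes.

Definition stirl (n j : nat) : int :=
  (\prod_(i < n) ('X - (i%:Z)%:P) : {poly int})`_j.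

Definition Ccoef (d r : nat) (i : int) : int :=
  (\prod_(j < d) ('X + (i - j%:Z)%:P) : {poly int})`_r.

(* The minimum over 1 <= i <= d - 2; the initial value is its term at i = 1,
   which belongs to the range since only d >= 3 is used. *)
Definition Mmin (r d : nat) : int :=
  \big[Order.min/Ccoef d r 1]_(1 <= i < d.-1) Ccoef d r i%:Z.

(* Main.v *)
Require Import Defs.
From mathcomp Require Import all_boot all_order all_algebra.
From mathcomp Require Import finmap.
From mathcomp Require Import all_classical all_reals all_analysis.
From mathcomp Require Import zify ring.

Set Implicit Arguments.
Unset Strict Implicit.
Unset Printing Implicit Defensive.

Import Order.TTheory GRing.Theory Num.Theory.

Local Open Scope ring_scope.

(** Let [P] be the hull of its vertices [v_j]. The lattice points of [k P] are
    the lattice points at height [k] of the cone [C] generated by the vectors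
    [a_j = (1, v_j)]. Following Stanley, [C] is cut into disjoint half-open
    simplicial cones, each spanned by a basis [B] of [a_j]; subtracting integer
    parts of coordinates maps each lattice point of [C] to one of finitely many
    reduced points, those whose coordinates lie in a half-open unit interval.
    If [h_i] is the number of reduced points of height [i], then
    [G(k P) = \sum_(i <= d) h_i 'C(k + d - i, d)] ([card_slice]), so that
    [d! g_r = \sum_i h_i C^d_(r, d - i)] ([binomial_basis_coef]) and
    [\sum_i h_i = d! g_d] ([binomial_basis_top]).

    The theorem then follows from four facts. The first is [h_i >= 0], which
    is built in. The second is [h_0 = 1] ([hstar0]), whose contribution is the
    Stirling number. The third is [h_d <= h_1]
    ([hstar_top_le]), where [h_1 = G(P) - (d + 1)]: reflecting a reduced point
    of height [d] in its half-open parallelepiped gives a lattice point of [P]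
    that is not a vertex, and there are at least [d + 1] vertices.
    The fourth is that [g_d] is the volume of [P] ([vol_hull]). For
    [2 <= i <= d - 1] the coefficient [C^d_(r, d - i)] is bounded below by the
    minimum [M]; the extreme terms [i = 1] and [i = d] are handled together,
    because [C^d_(r, 0) = (-1)^(d - r) C^d_(r, d - 1)] ([hstar_bound]).

    The triangulation comes from linear programming. Fix a generic cost [w] on
    the generators and call [B] a cell when some linear form agrees with [w]
    on [B] and is smaller than [w] elsewhere, that is, when [B] is an optimal
    basis. For a point [x] of [C] and a generic direction [q] in [C], the point
    [x + e q], for small [e > 0], is a positive combination of exactly one cell
    ([in_cell_exists], [in_cell_uniq]); this cell is the one to which [x]
    belongs, and the signs of the coordinates of [q] decide which facets
    belong to which half-open cone. Replacing [q] by [- q] gives the opposite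
    choice of facets, which is where the reflected points of the third fact
    live.

    The volume is computed without determinants. For a cover of [P] by boxes,
    compactness yields finitely many slightly larger open boxes, and counting
    the lattice points of their dilates bounds [G(k P)] by a polynomial in [k]
    whose top coefficient is their total volume. Conversely, the cubes of side
    [1 / k] meeting [P] cover it, and they are no more numerous than the
    lattice points of [(k + c) P], for a constant [c]. *)

(** * Bases of generators and support reduction *)

Section Cone.
Variables (R : realFieldType) (n d : nat) (A : 'M[R]_(n, d.+1)).
Implicit Types (B : {set 'I_n}) (u : 'rV[R]_n) (x y : 'rV[R]_d.+1).

Definition nonneg u := forall j, 0 <= u 0 j.
Definition supported B u := forall j, j \notin B -> u 0 j = 0.
Definition supp u : {set 'I_n} := [set j | u 0 j != 0].
Definition indep B := forall u, supported B u -> u *m A = 0 -> u = 0.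
(** The matrix sends a vector to coefficients on the generators of [B]; it
    doubles as a certificate that [B] spans. *)
Definition is_coordmx B (M : 'M[R]_(d.+1, n)) :=
  M *m A = 1%:M /\ forall i j, j \notin B -> M i j = 0.
Definition spanning B := exists M, is_coordmx B M.
Definition basis B := indep B /\ spanning B.
Definition coordmx B : 'M[R]_(d.+1, n) := xget 0 (is_coordmx B).
Definition coord B x := x *m coordmx B.

Lemma supported_supp u : supported (supp u) u.
Proof. by move=> j; rewrite inE negbK => /eqP. Qed.

Lemma coordmxP B : spanning B -> is_coordmx B (coordmx B).
Proof. by move=> [M HM]; exact: (xgetPex 0 (ex_intro _ M HM)). Qed.

Lemma coordK B x : spanning B -> coord B x *m A = x.
Proof. by move=> /coordmxP[MA _]; rewrite /coord -mulmxA MA mulmx1. Qed.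

Lemma coord_supp B x : spanning B -> supported B (coord B x).
Proof.
move=> /coordmxP[_ M0] j jB; rewrite /coord mxE big1// => i _.
by rewrite M0// mulr0.
Qed.

Lemma coord_uniq B u x : basis B -> supported B u -> u *m A = x ->
  u = coord B x.
Proof.
move=> [iB sB] su ux; apply/eqP; rewrite -subr_eq0; apply/eqP; apply: iB.
  by move=> j jB; rewrite mxE su// mxE coord_supp// oppr0 addr0.
by rewrite mulmxBl ux coordK// subrr.
Qed.

Lemma coord_row B j : basis B -> j \in B -> coord B (row j A) = delta_mx 0 j.
Proof.
move=> bB jB; rewrite -(@coord_uniq _ (delta_mx 0 j) _ bB) -?rowE//.
by move=> k kB; rewrite mxE/=; case: eqP kB => // ->; rewrite jB.
Qed.

Lemma coordD B x y : coord B (x + y) = coord B x + coord B y.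
Proof. by rewrite /coord mulmxDl. Qed.

Lemma coordB B x y : coord B (x - y) = coord B x - coord B y.
Proof. by rewrite /coord mulmxBl. Qed.

Lemma coordDZ B x e y j :
  coord B (x + e *: y) 0 j = coord B x 0 j + e * coord B y 0 j.
Proof. by rewrite /coord mulmxDl -scalemxAl mxE [X in _ + X]mxE. Qed.

Hypothesis fullA : row_full A.

(** A family that does not span is contained in a hyperplane, here the kernel
    of [phi], and the generators are not all in it. *)
Lemma not_spanning B : ~ spanning B -> exists phi : 'cV[R]_d.+1,
  (forall j, j \in B -> (A *m phi) j 0 = 0) /\ A *m phi != 0.
Proof.
move=> nsB.
pose AB := \matrix_(j < n, c < d.+1) (if j \in B then A j c else 0).
have [/row_fullP[M MAB]|] := boolP (row_full AB).
  exfalso; apply: nsB; exists (\matrix_(i, j) (if j \in B then M i j else 0)).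
  split; last by move=> i j /negbTE jB; rewrite mxE jB.
  rewrite -MAB; apply/matrixP => i c; rewrite !mxE; apply: eq_bigr => j _.
  by rewrite !mxE; case: ifP; rewrite ?mul0r ?mulr0.
rewrite -cokermx_eq0.
move=> K0; have [c Kc] : exists c, col c (cokermx AB) != 0.
  apply/existsP; apply: contraNT K0; rewrite negb_exists => /forallP Kc.
  apply/eqP/matrixP => i c; move: (Kc c); rewrite negbK => /eqP/matrixP/(_ i 0).
  by rewrite !mxE.
exists (col c (cokermx AB)); split; last first.
  have [M MA] := row_fullP fullA; apply: contraNneq Kc => AK.
  by rewrite -[col c _]mul1mx -MA -mulmxA AK mulmx0.
move=> j jB; have /matrixP/(_ j c) := mulmx_coker AB; rewrite 2!mxE => AK.
by rewrite mxE -[RHS]AK; apply: eq_bigr => k _; rewrite !mxE jB.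
Qed.

Hypothesis A0 : forall j, A j 0 = 1.

Lemma height_mul u : (u *m A) 0 0 = \sum_j u 0 j.
Proof. by rewrite mxE; apply: eq_bigr => j _; rewrite A0 mulr1. Qed.

(** The usual support reduction: an affine dependency [k] of the support can be
    followed, in the direction that does not increase the cost, until a weight
    vanishes; one does since the entries of [k] sum to zero. *)
Lemma caratheodory (w : 'cV[R]_n) u : nonneg u -> exists u',
  [/\ nonneg u', u' *m A = u *m A, indep (supp u')
    & (u' *m w) 0 0 <= (u *m w) 0 0].
Proof.
have [N] := ubnP #|supp u|; elim: N u => // N IH u uN u0.
have [iu|niu] := pselect (indep (supp u)); first by exists u.
have [k [sk kA k0 kw]] : exists k, [/\ supported (supp u) k, k *m A = 0,
    k != 0 & (k *m w) 0 0 <= 0].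
  have [k /not_implyP[sk /not_implyP[kA /eqP k0]]] := (existsNP _).2 niu.
  have [kw|kw] := leP ((k *m w) 0 0) 0; first by exists k.
  exists (- k); split => //.
  - by move=> j /sk kj; rewrite mxE kj oppr0.
  - by rewrite mulNmx kA oppr0.
  - by rewrite oppr_eq0.
  - by rewrite mulNmx mxE oppr_le0 ltW.
(* A dependency has entries of both signs because all generators have
   height 1. *)
have sumk : \sum_j k 0 j = 0 by rewrite -height_mul kA mxE.
have [j0 kj0] : exists j, k 0 j < 0.
  apply/existsP; apply: contraNT k0; rewrite negb_exists => /forallP kp.
  have kp' j : 0 <= k 0 j by rewrite leNgt.
  apply/eqP/rowP => j; rewrite mxE; apply/eqP; rewrite eq_le kp' andbT.
  by rewrite -sumk (bigD1 j)//= lerDl sumr_ge0.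
have [j1 kj1 jmin] := @arg_minP _ R _ j0 (fun j => k 0 j < 0)
  (fun j => u 0 j / - k 0 j) kj0.
(* The largest step that keeps the weights nonnegative; it cancels the
   weight at j1. *)
pose t := u 0 j1 / - k 0 j1.
have t0 : 0 <= t by rewrite divr_ge0// oppr_ge0 ltW.
pose v := u + t *: k.
have vj1 : v 0 j1 = 0.
  by rewrite !mxE /t invrN mulrN mulNr mulfVK ?subrr// lt_eqF.
have v0 : nonneg v.
  move=> j; rewrite !mxE; have [kj|kj] := leP 0 (k 0 j).
    by rewrite addr_ge0// mulr_ge0.
  by rewrite -lerBlDr sub0r -mulrN -ler_pdivlMr ?oppr_gt0//; apply: jmin.
have vA : v *m A = u *m A by rewrite mulmxDl -scalemxAl kA scaler0 addr0.
have vw : (v *m w) 0 0 <= (u *m w) 0 0.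
  rewrite mulmxDl -scalemxAl mxE gerDl mxE.
  exact: mulr_ge0_le0.
have : (#|supp v| < N)%N.
  rewrite -ltnS; apply: leq_trans uN; rewrite ltnS; apply: proper_card.
  apply/properP; split.
    apply/fintype.subsetP => j; rewrite !inE; apply: contraNN => /eqP uj.
    by rewrite !mxE uj sk ?mulr0 ?addr0// inE uj eqxx.
  exists j1; last by rewrite inE vj1 eqxx.
  by apply/negPn/negP => /sk kj; rewrite kj ltxx in kj1.
move=> /IH/(_ v0)[u' [H1 H2 H3 H4]]; exists u'; split => //.
  by rewrite H2.
exact: le_trans vw.
Qed.

End Cone.

(** * The regular triangulation and its half-open cells *)

Section GenericParameter.
Variable R : realFieldType.

(** The product of the nonzero [p i] is a nonzero polynomial, so it has
    finitely many roots. *)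
Lemma exists_nonroot_nat (I : finType) (p : I -> {poly R}) :
  exists k, (0 < k)%N /\ forall i, p i != 0 -> (p i).[k%:R] != 0.
Proof.
pose P := \prod_(i | p i != 0) p i.
have P0 : P != 0 by apply/prodf_neq0.
pose s := [seq i.+1%:R : R | i <- iota 0 (size P)].
have [/allP rs|] := boolP (all (root P) s).
  have us : uniq s.
    rewrite map_inj_uniq ?iota_uniq// => i j /eqP.
    by rewrite eqr_nat eqSS => /eqP.
  have := max_poly_roots P0 (introT allP rs) us.
  by rewrite size_map size_iota ltnn.
move=> /allPn[_ /mapP[k _ ->]]; rewrite /root => Pk.
exists k.+1; split=> // i pi; apply: contraNneq Pk => pik.
by rewrite /P (bigD1 i)//= hornerM pik mul0r.
Qed.

Lemma eq_poly_nat (p q : {poly R}) :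
  (forall k, (0 < k)%N -> p.[k%:R] = q.[k%:R]) -> p = q.
Proof.
move=> pq; apply/eqP; rewrite -subr_eq0; apply/negPn/negP => r0.
have [k [k0 /(_ tt r0)]] := exists_nonroot_nat (fun _ : unit => p - q).
by rewrite hornerD hornerN pq// subrr eqxx.
Qed.

(** The sign of [a + e * b] for infinitesimal [e > 0]. *)
Definition lexpos (a b : R) := (0 < a) || ((a == 0) && (0 < b)).

Lemma lexpos_total a b : b != 0 -> lexpos a b || lexpos (- a) (- b).
Proof.
rewrite /lexpos !oppr_gt0 oppr_eq0 => b0.
by case: (ltgtP a 0); case: (ltgtP b 0) b0; rewrite //= ?eqxx.
Qed.

Lemma lexpos_small (I : finType) (a b : I -> R) : exists2 e0 : R, 0 < e0 &
  forall e, 0 < e <= e0 -> forall i, (0 < a i + e * b i) = lexpos (a i) (b i).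
Proof.
have H i : exists2 e0 : R, 0 < e0 &
    forall e, 0 < e <= e0 -> (0 < a i + e * b i) = lexpos (a i) (b i).
  rewrite /lexpos; have [->|ai0] := eqVneq (a i) 0.
    by exists 1 => // e /andP[e0 _]; rewrite ltxx add0r/= pmulr_rgt0.
  have b1 : 0 < `|b i| + 1 by rewrite ltr_wpDl.
  exists (`|a i| / (`|b i| + 1)); first by rewrite divr_gt0// normr_gt0.
  move=> e /andP[e0 ]; rewrite ler_pdivlMr// => eab.
  have : `|e * b i| < `|a i|.
    by rewrite normrM (gtr0_norm e0); apply: lt_le_trans eab; rewrite
      ltr_pM2l// ltrDl.
  rewrite andFb orbF; have [ai|ai|ai] := ltgtP 0 (a i).
  - by rewrite (gtr0_norm ai) ltr_norml => /andP[+ _]; rewrite -subr_gt0 opprK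
    addrC.
  - rewrite (ltr0_norm ai) ltr_norml => /andP[_ +]; rewrite -subr_lt0 opprK
    addrC.
    by move=> /ltW; rewrite leNgt => /negbTE.
  - by rewrite -ai eqxx in ai0.
have {}H : forall s : seq I, exists2 e0 : R, 0 < e0 & forall e, 0 < e <= e0 ->
    forall i, i \in s -> (0 < a i + e * b i) = lexpos (a i) (b i).
  elim=> [|i s [e0 e00 IH]]; first by exists 1.
  have [e1 e10 Hi] := H i; exists (Num.min e0 e1); first by rewrite lt_min e00.
  move=> e /andP[ep]; rewrite le_min => /andP[ee0 ee1] k.
  rewrite inE => /predU1P[->|ks]; first by apply: Hi; rewrite ep.
  by apply: IH; rewrite ?ep.
have [e0 e00 {}H] := H (enum I); exists e0 => // e ee i.
by apply: H; rewrite ?mem_enum.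
Qed.

End GenericParameter.

Section Triangulation.
Variables (R : realFieldType) (n d : nat) (A : 'M[R]_(n, d.+1)).
Implicit Types (B S : {set 'I_n}) (u : 'rV[R]_n) (x y q : 'rV[R]_d.+1).
Variable w : 'cV[R]_n.

(** [p] is an optimal solution of the dual of the linear program that
    minimizes the cost of the nonnegative representations of a point of the
    cone over [B]; optimality is required to be strict outside [B]. *)
Definition cell B := basis A B /\ exists p : 'cV[R]_d.+1, forall j,
  if j \in B then (A *m p) j 0 = w j 0 else (A *m p) j 0 < w j 0.

(** For small [e > 0] the point [x + e *: q] is in the interior of the cone
    spanned by [B]. *)
Definition in_cell q B x :=
  cell B /\ forall j, j \in B -> lexpos (coord A B x 0 j) (coord A B q 0 j).

(** Weak duality: the value of the dual solution bounds the cost of every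
    representation, with equality only for those supported by [B]. *)
Lemma cell_cost B : cell B -> exists p : 'cV[R]_d.+1,
  (forall u, supported B u -> (u *m w) 0 0 = (u *m A *m p) 0 0) /\
  (forall u, nonneg u -> (u *m A *m p) 0 0 <= (u *m w) 0 0 /\
     ((u *m w) 0 0 <= (u *m A *m p) 0 0 -> supported B u)).
Proof.
move=> [_ [p Hp]]; exists p.
have E u : (u *m w) 0 0 - (u *m A *m p) 0 0 =
           \sum_j u 0 j * (w j 0 - (A *m p) j 0).
  rewrite -mulmxA [(u *m w) _ _]mxE [(u *m (A *m p)) _ _]mxE -sumrB.
  by apply: eq_bigr => j _; rewrite mulrBr.
split=> u Hu.
  apply/eqP; rewrite -subr_eq0 E big1// => j _; have := Hp j.
  by case: ifPn => [_ ->|/Hu -> _]; rewrite ?subrr ?mulr0 ?mul0r.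
have T0 j : 0 <= u 0 j * (w j 0 - (A *m p) j 0).
  apply: mulr_ge0 => //; rewrite subr_ge0; have := Hp j.
  by case: ifP => _ => [->//|/ltW].
split; first by rewrite -subr_ge0 E sumr_ge0.
rewrite -subr_le0 E => le0 j jB.
have : \sum_j u 0 j * (w j 0 - (A *m p) j 0) == 0.
  by rewrite eq_le le0 sumr_ge0.
rewrite psumr_eq0// => /allP/(_ j); rewrite mem_index_enum => /(_ isT)/=.
have := Hp j; rewrite (negbTE jB) => /gt_eqF lt; rewrite mulf_eq0 subr_eq0 lt.
by rewrite orbF => /eqP.
Qed.

(** Both representations are optimal for their own cells, hence have the same
    cost, so each is supported by the other cell. *)
Lemma cell_uniq B B' u u' : cell B -> cell B' ->
  supported B u -> (forall j, j \in B -> 0 < u 0 j) ->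
  supported B' u' -> (forall j, j \in B' -> 0 < u' 0 j) ->
  u *m A = u' *m A -> B = B'.
Proof.
have pos (C : {set 'I_n}) (v : 'rV[R]_n) : supported C v -> (forall j, j \in C
  -> 0 < v 0 j) -> nonneg v.
  by move=> sC vC j; have [/vC/ltW//|/sC->] := boolP (j \in C).
have sub (C C' : {set 'I_n}) (v : 'rV[R]_n) : supported C' v -> (forall j, j
  \in C -> 0 < v 0 j) -> C \subset C'.
  move=> sC vC; apply/fintype.subsetP => j /vC; apply: contraTT => /sC ->.
  by rewrite ltxx.
move=> /cell_cost[p [p1 p2]] /cell_cost[p' [p1' p2']] sB uB sB' uB' E.
have u0 := pos _ _ sB uB; have u0' := pos _ _ sB' uB'.
have [le1 eq1] := p2 _ u0'; have [le2 eq2] := p2' _ u0.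
have e1 := p1 _ sB; have e2 := p1' _ sB'.
apply/eqP; rewrite finset.eqEsubset; apply/andP; split; [apply: sub uB|apply:
  sub uB'].
  by apply: eq2; rewrite E -e2 e1 E.
by apply: eq1; rewrite e2 -E -e1.
Qed.

Lemma in_cell_uniq q B B' x : in_cell q B x -> in_cell q B' x -> B = B'.
Proof.
move=> [cB HB] [cB' HB'].
have [e1 e10 H1] := lexpos_small (fun j => coord A B x 0 j) (fun j => coord A
  B q 0 j).
have [e2 e20 H2] := lexpos_small (fun j => coord A B' x 0 j) (fun j => coord A
  B' q 0 j).
pose e := Num.min e1 e2; have e0 : 0 < e by rewrite lt_min e10.
have [[_ sB] _] := cB; have [[_ sB'] _] := cB'.
apply: (@cell_uniq _ _ (coord A B (x + e *: q)) (coord A B' (x + e *: q))) =>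
  //.
- exact: coord_supp.
- by move=> j jB; rewrite coordDZ H1 ?HB// e0 ge_min lexx.
- exact: coord_supp.
- by move=> j jB; rewrite coordDZ H2 ?HB'// e0 ge_min lexx orbT.
- by rewrite !coordK.
Qed.

Lemma in_cell_coord q B x : in_cell q B x -> nonneg (coord A B x).
Proof.
move=> [[[_ sB] _] H] j; have [/H|/(coord_supp _ sB)->//] := boolP (j \in B).
by move=> /orP[/ltW//|/andP[/eqP->]].
Qed.

Hypothesis A0 : forall j, A j 0 = 1.
Hypothesis wgen : forall B j, basis A B -> j \notin B ->
  (A *m coordmx A B *m w) j 0 != w j 0.

(** Among the bases in which [y] has positive coordinates, one of least cost
    is a cell. If a generator [j] violated dual feasibility, moving [y] a
    little towards it in the representation would lower the cost, and support
    reduction would give a cheaper basis. The assumption on [y] turns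
    independent supports into bases. *)
Lemma cell_exists u y : (forall v, v *m A = y -> spanning A (supp v)) ->
  nonneg u -> u *m A = y ->
  exists B, cell B /\ forall j, j \in B -> 0 < coord A B y 0 j.
Proof.
move=> ndy u0 uy.
have bs v : nonneg v -> v *m A = y -> indep A (supp v) ->
    basis A (supp v) /\ coord A (supp v) y = v.
  move=> v0 vy iv; have bv : basis A (supp v) by split=> //; apply: ndy.
  by split=> //; rewrite -(coord_uniq bv _ vy)//; exact: supported_supp.
pose ok S := `[< basis A S /\ forall j, j \in S -> 0 < coord A S y 0 j >].
have okv v : nonneg v -> v *m A = y -> indep A (supp v) -> ok (supp v).
  move=> v0 vy iv; have [bv cv] := bs _ v0 vy iv; apply/asboolP; split=> // j.
  by rewrite cv inE lt0r v0 andbT.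
have [v [v0 vy iv _]] := caratheodory A0 w u0.
case: (@arg_minP _ R _ (supp v) ok
  (fun S => (coord A S y *m w) 0 0) (okv _ v0 (etrans vy uy) iv)).
move=> B okB Bmin.
have {okB} [bB cB] := asboolW okB.
exists B; split=> //; split=> //; exists (coordmx A B *m w) => j.
have [iB sB] := bB.
have [jB|jB] := boolP (j \in B).
  have -> : A *m (coordmx A B *m w) = (A *m coordmx A B) *m w by rewrite mulmxA.
  have := coord_row bB jB.
  rewrite /coord -row_mul => Ej.
  have -> : (A *m coordmx A B *m w) j 0 = (row j (A *m coordmx A B *m w)) 0 0
    by rewrite [RHS]mxE.
  by rewrite row_mul Ej -rowE mxE.
rewrite mulmxA lt_neqAle wgen//= leNgt; apply/negP => cj.
(* The direction a trades the representation of the generator j in B for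
   the generator itself. *)
pose l := coord A B y; pose a := delta_mx 0 j - coord A B (row j A).
have [e e0 He] := lexpos_small (fun k => l 0 k) (fun k => a 0 k).
have {}He := He e; rewrite e0 lexx in He; have {}He := He isT.
pose v' := l + e *: a.
have v'0 : nonneg v'.
  move=> k; rewrite /v' mxE [X in _ + X]mxE; have [kB|kB] := boolP (k \in B).
    by have := He k; rewrite /lexpos cB//= => /ltW.
  rewrite /l (coord_supp _ sB)// add0r.
  have -> : a 0 k = (k == j)%:R.
    have Ek := coord_supp (row j A) sB kB.
    by rewrite mxE [X in _ + X]mxE Ek subr0 mxE.
  by rewrite mulr_ge0 ?ler0n// ltW.
have v'y : v' *m A = y.
  by rewrite /v' mulmxDl -scalemxAl mulmxBl -rowE !coordK// subrr scaler0 addr0.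
have v'w : (v' *m w) 0 0 < (l *m w) 0 0.
  rewrite /v' mulmxDl -scalemxAl [in ltLHS]mxE gtrDl mxE.
  rewrite pmulr_rlt0//; have -> : (a *m w) 0 0 = w j 0 - (A *m coordmx A B *m
    w) j 0.
    by rewrite mulmxBl -rowE /coord -!row_mul !mxE.
  by rewrite subr_lt0.
have [v'' [v''0 v''y iv'' v''w]] := caratheodory A0 w v'0.
have E : v'' *m A = y by rewrite v''y.
have := Bmin _ (okv _ v''0 E iv''); rewrite (bs _ v''0 E iv'').2.
by rewrite leNgt (le_lt_trans v''w v'w).
Qed.

(** For small [e] the point [x + e *: q] avoids each hyperplane spanned by
    generators, because [q] does, and [cell_exists] applies to it. *)
Lemma in_cell_exists q (tau u : 'rV[R]_n) x :
  (forall S, ~ spanning A S -> exists phi : 'cV[R]_d.+1,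
    (forall j, j \in S -> (A *m phi) j 0 = 0) /\ (q *m phi) 0 0 != 0) ->
  nonneg tau -> q = tau *m A -> nonneg u -> x = u *m A ->
  exists B, in_cell q B x.
Proof.
move=> qgen tau0 qE u0 xE.
pose good S (phi : 'cV[R]_d.+1) := ~ spanning A S ->
    (forall j, j \in S -> (A *m phi) j 0 = 0) /\ (q *m phi) 0 0 != 0.
have /choice[phi Hphi] : forall S, exists phi, good S phi.
  move=> S; have [sS|/qgen[phi H]] := pselect (spanning A S); first by exists 0.
  by exists phi.
have [e1 e10 H1] := lexpos_small (fun S => (x *m phi S) 0 0) (fun S => (q *m
  phi S) 0 0).
have [e2 e20 H2] := lexpos_small (fun S => - (x *m phi S) 0 0) (fun S => - (q
  *m phi S) 0 0).
have [e3 e30 H3] := lexpos_small (fun Sj : {set 'I_n} * 'I_n => coord A Sj.1 x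
  0 Sj.2)
   (fun Sj => coord A Sj.1 q 0 Sj.2).
pose e := Num.min e1 (Num.min e2 e3).
have e0 : 0 < e by rewrite !lt_min e10 e20.
have l1 : e <= e1 by rewrite ge_min lexx.
have l2 : e <= e2 by rewrite !ge_min lexx orbT.
have l3 : e <= e3 by rewrite !ge_min lexx !orbT.
have [] := @cell_exists (u + e *: tau) (x + e *: q).
- move=> v vy; apply: contrapT => /[dup] ns /Hphi[A0S qS0].
  have : (v *m A *m phi (supp v)) 0 0 = 0.
    rewrite -mulmxA mxE big1// => j _; have [/A0S->|] := boolP (j \in supp v).
      by rewrite mulr0.
    by move=> /supported_supp->; rewrite mul0r.
  rewrite vy mulmxDl -scalemxAl mxE [X in _ + X]mxE => E.
  have := lexpos_total ((x *m phi (supp v)) 0 0) qS0.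
  rewrite -(H1 e) ?e0// -(H2 e) ?e0// E ltxx mulrN -opprD E oppr0 ltxx.
  by [].
- by move=> j; rewrite !mxE addr_ge0// mulr_ge0// ltW.
- by rewrite mulmxDl -scalemxAl xE qE.
move=> B [cB HB]; exists B; split=> // j jB.
by have := HB j jB; rewrite coordDZ (H3 e _ (B, j))// e0.
Qed.

End Triangulation.

(** * Generic costs and directions *)

Section Genericity.
Variables (R : realFieldType) (n d : nat) (A : 'M[R]_(n, d.+1)).
Implicit Types (B S : {set 'I_n}).

Definition generic_cost (w : 'cV[R]_n) := forall B j, basis A B -> j \notin B ->
  (A *m coordmx A B *m w) j 0 != w j 0.

(** [q] is in no proper subspace spanned by generators. *)
Definition generic_dir (q : 'rV[R]_d.+1) := forall S, ~ spanning A S ->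
  exists phi : 'cV[R]_d.+1,
    (forall j, j \in S -> (A *m phi) j 0 = 0) /\ (q *m phi) 0 0 != 0.

Lemma rVpoly_horner (v : 'rV[R]_n) t :
  (rVpoly v).[t] = (v *m \col_j t ^+ j) 0 0.
Proof.
rewrite horner_poly mxE; apply: eq_bigr => k _.
by rewrite insubT//= => ?; rewrite mxE; congr (v _ _ * _); apply: val_inj.
Qed.

(** The powers of a suitable [t] are generic: a violated condition makes [t] a
    root of a polynomial whose coefficient of degree [j] is [-1]. *)
Lemma exists_generic_cost : exists w, generic_cost w.
Proof.
pose p (Bj : {set 'I_n} * 'I_n) : {poly R} :=
  rVpoly (row Bj.2 (A *m coordmx A Bj.1) - delta_mx 0 Bj.2).
have [t [_ Ht]] := exists_nonroot_nat p.
exists (\col_j t%:R ^+ j) => B j [_ /coordmxP[_ M0]] jB.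
have p0 : p (B, j) != 0.
  apply/negP => /eqP/(congr1 (coefp j)); rewrite /= coef_rVpoly_ord coef0.
  rewrite !mxE eqxx big1 => [/eqP|k _]; last by rewrite M0 ?mulr0.
  by rewrite eqxx/= sub0r oppr_eq0 oner_eq0.
have := Ht _ p0; rewrite rVpoly_horner mulmxBl -rowE -row_mul.
apply: contraNneq => E.
by rewrite mxE [X in X + _]mxE [X in _ + X]mxE [X in - X]mxE E subrr.
Qed.

(** The weights are powers of some [t]: with [phi] the linear form of
    [not_spanning], the value of [phi] at the combination is a nonzero
    polynomial in [t]. *)
Lemma exists_generic_dir : row_full A ->
  exists tau : 'rV[R]_n, (forall j, 0 < tau 0 j) /\ generic_dir (tau *m A).
Proof.
move=> fullA.
pose good S (phi : 'cV[R]_d.+1) := ~ spanning A S ->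
    (forall j, j \in S -> (A *m phi) j 0 = 0) /\ A *m phi != 0.
have /choice[phi Hphi] : forall S, exists phi, good S phi.
  move=> S; have [sS|/(not_spanning fullA)[phi H]] := pselect (spanning A S);
    first by exists 0.
  by exists phi.
have [t [t0 Ht]] := exists_nonroot_nat (fun S => rVpoly (A *m phi S)^T).
exists (\row_j t%:R ^+ j); split=> [j|S nS].
  by rewrite mxE exprn_gt0// ltr0n.
have [H1 H2] := Hphi _ nS; exists (phi S); split=> //.
have p0 : rVpoly (A *m phi S)^T != 0.
  apply: contraNneq H2 => /(congr1 (poly_rV (d := n))); rewrite rVpolyK linear0.
  by move=> /(congr1 trmx); rewrite trmxK trmx0 => ->.
have := Ht _ p0; rewrite -mulmxA rVpoly_horner; apply: contraNneq.
rewrite !mxE => E; apply/eqP; rewrite -[RHS]E; apply: eq_bigr => k _.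
by rewrite mulrC; congr (_ * _); rewrite [LHS]mxE// [RHS]mxE.
Qed.

(** The matrix of coordinates of all generators in [B] has diagonal entry 1 at
    the members of [B] and 0 elsewhere, so its trace is [#|B|]; the product of
    its two factors in the other order is the identity. *)
Lemma card_basis B : basis A B -> #|B| = d.+1.
Proof.
move=> bB; have [_ /coordmxP[MA M0]] := bB; apply/eqP; rewrite -(eqr_nat R).
have <- : \tr (coordmx A B *m A) = d.+1%:R by rewrite MA mxtrace1.
rewrite mxtrace_mulC /mxtrace (bigID (mem B))/= [X in _ + X]big1 => [|j jB].
  rewrite addr0 -sum1_card natr_sum; apply/eqP; apply: eq_bigr => j jB.
  have : coord A B (row j A) 0 j = 1 by rewrite coord_row// mxE !eqxx.
  by rewrite /coord -row_mul mxE => ->.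
by rewrite mxE big1// => k _; rewrite M0 ?mulr0.
Qed.

Lemma basis_enum B : basis A B -> exists e : 'I_d.+1 -> 'I_n,
  injective e /\ forall j, (j \in B) = (j \in codom e).
Proof.
move=> /card_basis cB; exists (fun i => enum_val (cast_ord (esym cB) i)); split.
  by move=> i j /enum_val_inj/cast_ord_inj.
move=> j; apply/idP/codomP => [jB|[i ->]]; last exact: enum_valP.
by exists (cast_ord cB (enum_rank_in jB j)); rewrite cast_ordK enum_rankK_in.
Qed.

(** Otherwise [q] would be in the span of [B] minus [j]. *)
Lemma generic_dir_coord q B j : generic_dir q -> basis A B -> j \in B ->
  coord A B q 0 j != 0.
Proof.
move=> gq bB jB; have [iB sB] := bB; apply/eqP => qj0.
have ns : ~ spanning A (B :\ j).
  move=> sBj; have bBj : supported B (coord A (B :\ j) (row j A)).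
    move=> k kB; apply: (coord_supp _ sBj); rewrite !inE; move/negbTE: kB => ->.
    by rewrite andbF.
  have E := coord_uniq bB bBj (coordK _ sBj); rewrite (coord_row bB jB) in E.
  have : coord A (B :\ j) (row j A) 0 j = 0.
    by apply: (coord_supp _ sBj); rewrite !inE eqxx.
  by rewrite E mxE !eqxx => /eqP; rewrite oner_eq0.
have [phi [phi0 /eqP]] := gq _ ns; apply.
rewrite -(coordK q sB) -mulmxA mxE big1// => k _.
have [->|kj] := eqVneq k j; first by rewrite qj0 mul0r.
have [kB|kB] := boolP (k \in B); first by rewrite phi0 ?mulr0// !inE kj.
by rewrite coord_supp ?mul0r.
Qed.

End Genericity.

(** * Counting lattice points of the cone by height *)

Section IntegerVectors.
Variable R : realType.

Lemma finite_bounded_int (m N : nat) :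
  finite_set [set x : 'rV[R]_m | x \is a mxOver Num.int /\
                                 forall c, `|x 0 c| <= N%:R]%classic.
Proof.
pose f (t : {ffun 'I_m -> 'I_(N + N).+1}) : 'rV[R]_m :=
  \row_c ((t c)%:R - N%:R).
apply: (@sub_finite_set _ _ (f @` setT)%classic); last
  exact/finite_image/finite_finset.
move=> x [/mxOverP xi xN]; have xf c : exists k : 'I_(N + N).+1, x 0 c = k%:R
  - N%:R.
  have [z xz] := intrP (xi 0 c); have := xN c; rewrite xz ler_norml => /andP[].
  rewrite -[N%:R]/(N%:~R) -mulrNz !ler_int => z1 z2.
  have zN : (`|(z + N%:Z)%R|%N < (N + N).+1)%N by lia.
  exists (Ordinal zN) => /=.
  have E : z = `|(z + N%:Z)%R|%N%:Z - N%:Z by lia.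
  by rewrite [in LHS]E intrB mulrNz.
have [t Ht] := choice xf; exists (finfun t) => //.
by apply/rowP => c; rewrite mxE ffunE Ht.
Qed.

(** The integer by which a coordinate [c] is reduced: what remains lies
    between 0 included and 1 excluded when the coordinate [s] of the direction
    is positive, so that the facet belongs to the cell, and between 0 excluded
    and 1 included otherwise. *)
Definition part (c s : R) : int :=
  if 0 < s then Num.floor c else Num.ceil c - 1.

Lemma lexposE (c s : R) : lexpos c s = if 0 < s then 0 <= c else 0 < c.
Proof. by rewrite /lexpos; case: ifP => _; rewrite ?andbT ?andbF ?orbF//
  le_eqVlt orbC eq_sym. Qed.

Lemma part_ge0 c s : lexpos c s -> 0 <= part c s.
Proof.
rewrite lexposE /part; case: ifP => _; first by rewrite floor_ge0.
by rewrite -ceil_gt0 => c0; lia.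
Qed.

Lemma partD c s (z : int) : part (c + z%:~R) s = part c s + z.
Proof.
rewrite /part; case: ifP => _; first by rewrite floorDrz ?intr_int// intrKfloor.
by rewrite ceilDrz ?intr_int// intrKceil addrAC.
Qed.

Lemma part_eq0 c s : (part c s == 0) = if 0 < s then 0 <= c < 1 else 0 < c <= 1.
Proof.
rewrite /part; case: ifP => _.
  by rewrite floor_eq /= add0r.
by rewrite subr_eq0 ceil_eq /= subrr.
Qed.

End IntegerVectors.

Section Counting.
Variables (R : realType) (n d : nat) (A : 'M[R]_(n, d.+1)).
Variables (w : 'cV[R]_n) (tau : 'rV[R]_n).
Implicit Types (B S : {set 'I_n}) (u : 'rV[R]_n) (x y : 'rV[R]_d.+1).
Hypothesis A0 : forall j, A j 0 = 1.
Hypothesis Aint : A \is a mxOver Num.int.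
Hypothesis wgen : generic_cost A w.
Hypothesis tau0 : forall j, 0 < tau 0 j.
Hypothesis qgen : generic_dir A (tau *m A).
Let q := tau *m A.

Definition cone x := exists u, nonneg u /\ x = u *m A.

Definition int_cone x := x \is a mxOver Num.int /\ cone x.

Definition cell_of x : {set 'I_n} := xget finset.set0 (in_cell A w q ^~ x).

Lemma cell_ofP x : cone x -> in_cell A w q (cell_of x) x.
Proof.
move=> [u [u0 xE]].
have tau_ge0 : nonneg tau by move=> j; apply: ltW.
have [B HB] := in_cell_exists A0 wgen qgen tau_ge0 (erefl q) u0 xE.
exact: (@xgetPex _ finset.set0 (in_cell A w q ^~ x) (ex_intro _ B HB)).
Qed.

Lemma cell_of_eq B x : in_cell A w q B x -> cell_of x = B.
Proof.
move=> HB; apply: in_cell_uniq (HB); exact: (@xgetPex _ finset.set0 (in_cell A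
  w q ^~ x) (ex_intro _ B HB)).
Qed.

Lemma in_cell_cone B x : in_cell A w q B x -> cone x.
Proof.
move=> HB; exists (coord A B x); split; first exact: in_cell_coord HB.
by rewrite coordK//; case: HB => [[[]]].
Qed.

Lemma cone_bound x k c : cone x -> x 0 0 <= k ->
  `|x 0 c| <= k * (\sum_j `|A j c|).
Proof.
move=> [u [u0 ->]]; rewrite height_mul// => uk.
rewrite mxE (le_trans (ler_norm_sum _ _ _))// mulr_sumr ler_sum// => j _.
rewrite normrM (ger0_norm (u0 j)) ler_wpM2r// (le_trans _ uk)//.
by rewrite (bigD1 j)//= lerDl sumr_ge0.
Qed.

Lemma finite_cone (k : R) :
  finite_set [set x | int_cone x /\ x 0 0 <= k]%classic.
Proof.
pose N := Num.truncn (\sum_c `|k * (\sum_j `|A j c|)|).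
apply: sub_finite_set (finite_bounded_int R d.+1 N.+1) => x [[xi xc] xk].
split=> // c; apply: (le_trans (cone_bound c xc xk)).
apply: (le_trans _ (ltW (truncnS_gt _))); rewrite (le_trans (ler_norm _))//.
by rewrite (bigD1 c)//= lerDl sumr_ge0.
Qed.

Lemma height_ge0 x : cone x -> 0 <= x 0 0.
Proof. by move=> [u [u0 ->]]; rewrite height_mul// sumr_ge0. Qed.

Lemma height_nat x : int_cone x -> exists k : nat, x 0 0 = k%:R.
Proof.
move=> [/mxOverP xi /height_ge0 x0].
by apply/natrP; rewrite natrEint xi x0.
Qed.

Definition ipart B x : 'rV[R]_n :=
  \row_j (if j \in B then (part (coord A B x 0 j) (coord A B q 0 j))%:~R else
    0).

Definition red x := x - ipart (cell_of x) x *m A.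

Definition lattice_slice (k : nat) : {fset 'rV[R]_d.+1} :=
  fset_set [set x | int_cone x /\ x 0 0 = k%:R]%classic.

(** The reduced points are the lattice points of the half-open unit
    parallelepipeds of all cells. *)
Definition reduced : {fset 'rV[R]_d.+1} :=
  fset_set [set x | int_cone x /\ red x = x]%classic.

Definition hstar (i : nat) : nat := #|` [fset x in reduced | x 0 0 ==
  i%:R]%fset|.

Lemma in_slice k x : x \in lattice_slice k <-> int_cone x /\ x 0 0 = k%:R.
Proof.
rewrite in_fset_set ?in_setE//; apply: sub_finite_set (finite_cone k%:R) => y.
by move=> [? /= yk]; split=> //; rewrite yk.
Qed.

Lemma ipart_supp B x : supported B (ipart B x).
Proof. by move=> j /negbTE jB; rewrite mxE jB. Qed.

Lemma ipart_nat B x : in_cell A w q B x ->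
  exists nu : 'I_n -> nat, forall j, ipart B x 0 j = (nu j)%:R.
Proof.
move=> [_ H]; exists (fun j => if j \in B then absz (part (coord A B x 0 j)
  (coord A B q 0 j)) else 0%N).
move=> j; rewrite mxE; case: ifP => // /H/part_ge0.
by case: (part _ _).
Qed.

Lemma mulA_int u : u \is a mxOver Num.int -> u *m A \is a mxOver Num.int.
Proof. by move=> ui; apply: mxOverM. Qed.

Lemma int_sub x y : x \is a mxOver Num.int -> y \is a mxOver Num.int ->
  x - y \is a mxOver Num.int.
Proof.
move=> /mxOverP xi /mxOverP yi; apply/mxOverP => i j.
by rewrite mxE [X in _ + X]mxE rpredB.
Qed.

Lemma ipart_int B x : ipart B x \is a mxOver Num.int.
Proof. by apply/mxOverP => i j; rewrite mxE; case: ifP => _; rewrite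
  ?intr_int// rpred0. Qed.

Lemma coord_shift B u x : basis A B -> supported B u ->
  coord A B (x + u *m A) = coord A B x + u.
Proof. by move=> bB su; rewrite coordD -(coord_uniq bB su (erefl _)). Qed.

Lemma ipart_shift B x (nu : 'I_n -> int) (u := \row_j (nu j)%:~R) :
  basis A B -> supported B u -> ipart B (x + u *m A) = ipart B x + u.
Proof.
move=> bB su; apply/rowP => j; rewrite mxE coord_shift//.
rewrite [RHS]mxE [ipart B x 0 j]mxE [(_ + u) 0 j]mxE; case: ifP => jB.
  by rewrite [u 0 j]mxE partD intrD.
by rewrite su ?jB// addr0.
Qed.

Lemma redP x : int_cone x -> [/\ int_cone (red x), cell_of (red x) = cell_of x,
  ipart (cell_of x) (red x) = 0 & in_cell A w q (cell_of x) (red x)].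
Proof.
move=> [xi /cell_ofP]; rewrite /red; set B := cell_of x => HB.
have [cB H] := HB; have bB : basis A B by case: cB.
pose nu j := if j \in B then - part (coord A B x 0 j) (coord A B q 0 j) else 0.
have nuE : - ipart B x = \row_j (nu j)%:~R.
  by apply/rowP => j; rewrite mxE [X in - X]mxE [RHS]mxE /nu; case: ifP;
    rewrite ?mulrNz ?oppr0.
have sN : supported B (- ipart B x).
  by move=> j jB; rewrite mxE ipart_supp ?oppr0.
have iE : ipart B (x - ipart B x *m A) = 0.
  by rewrite -mulNmx nuE ipart_shift -?nuE// subrr.
have HB' : in_cell A w q B (x - ipart B x *m A).
  split=> // j jB; have /eqP : ipart B (x - ipart B x *m A) 0 j = 0.
    by rewrite iE mxE.
  by rewrite mxE jB intr_eq0 part_eq0 lexposE; case: ifP => _ /andP[].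
split=> //; last exact: cell_of_eq.
split; last exact: in_cell_cone HB'.
exact/int_sub/mulA_int/ipart_int.
Qed.

Lemma red_eqP x B : in_cell A w q B x -> (red x == x) = (ipart B x == 0).
Proof.
move=> HB; rewrite /red (cell_of_eq HB) -subr_eq0 addrAC subrr sub0r oppr_eq0.
have [[[iB _] _] _] := HB; apply/eqP/eqP => [E|->]; last by rewrite mul0mx.
by apply: iB => //; apply: ipart_supp.
Qed.

Lemma sum_coord B x : spanning A B -> \sum_(j in B) coord A B x 0 j = x 0 0.
Proof.
move=> sB; rewrite -[in RHS](coordK x sB) height_mul// [RHS](bigID (mem B))/=.
by rewrite [X in _ = _ + X]big1 ?addr0// => j jB; rewrite coord_supp.
Qed.

(** The coordinates of [q] in [B] sum to its height, which is positive. *)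
Lemma cell_dir_gt0 B : basis A B -> exists2 j, j \in B & 0 < coord A B q 0 j.
Proof.
move=> bB; apply/exists_inP; apply: contraT; rewrite negb_exists_in =>
  /forall_inP H.
have [_ sB] := bB; have S := sum_coord q sB.
have : \sum_(j in B) coord A B q 0 j <= 0.
  by apply: sumr_le0 => j /H; rewrite -leNgt.
rewrite S height_mul// leNgt => /negP; case.
have : (0 < #|B|)%N by rewrite (card_basis bB).
case/card_gt0P => j _; rewrite (bigD1 j)//= ltr_wpDr// sumr_ge0// => k _.
exact: ltW.
Qed.

Lemma red_coord B x : in_cell A w q B x -> red x = x -> forall j, j \in B ->
  if 0 < coord A B q 0 j then 0 <= coord A B x 0 j < 1
  else 0 < coord A B x 0 j <= 1.
Proof.
move=> HB /eqP; rewrite (red_eqP HB) => /eqP iB j jB; rewrite -part_eq0.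
have : ipart B x 0 j = 0 by rewrite iB mxE.
by rewrite mxE jB => /eqP; rewrite intr_eq0.
Qed.

(** The [d + 1] coordinates are at most 1, and one of them is less than 1 by
    [cell_dir_gt0]. This is why the heights of reduced points stop at [d]. *)
Lemma reduced_height x : cone x -> red x = x -> x 0 0 < d.+1%:R.
Proof.
move=> /cell_ofP HB rx; have {}rx := red_coord HB rx; set B := cell_of x in HB
  rx.
have [[bB _] _] := HB; have [_ sB] := bB.
have [j jB qj] := cell_dir_gt0 bB.
rewrite -(sum_coord x sB) -(card_basis bB) -sum1_card natr_sum.
rewrite (bigD1 j)//= [ltRHS](bigD1 j)//=; apply: ltr_leD.
  by have := rx j jB; rewrite qj => /andP[].
apply: ler_sum => k /andP[kB _]; have := rx k kB.
by case: ifP => _ /andP[_]// /ltW.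
Qed.

Lemma in_reduced x : x \in reduced <-> int_cone x /\ red x = x.
Proof.
rewrite in_fset_set ?in_setE//; apply: sub_finite_set (finite_cone d.+1%:R) =>
  y.
by move=> [yc ry]; split=> //; apply/ltW/reduced_height => //; case: yc.
Qed.

Lemma red_height x : x 0 0 = (red x) 0 0 + \sum_j ipart (cell_of x) x 0 j.
Proof.
by rewrite -(height_mul A0) /red mxE [X in _ + X + _]mxE subrK.
Qed.

(** The points over [p] are [p] plus natural combinations of the [d + 1]
    generators of its cell, with coefficients of sum [k - i]. *)
Lemma card_fibre p i k :
  int_cone p -> red p = p -> p 0 0 = i%:R -> (i <= d)%N ->
  #|` [fset x in lattice_slice k | red x == p]%fset| = 'C(k + d - i, d).
Proof.
move=> [pint pcone] rp pi id; have HB := cell_ofP pcone.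
set B := cell_of p in HB; have [cB HBp] := HB; have [bB _] := cB; have [iB sB]
  := bB.
have ip0 : ipart B p = 0 by apply/eqP; rewrite -(red_eqP HB) rp.
have [ki|ik] := ltnP k i.
  rewrite bin_small; last by lia.
  apply/eqP; rewrite cardfs_eq0; apply/eqP/fsetP => x; rewrite !inE/=.
  apply/negP => /andP[/in_slice[xc xk] /eqP rx].
  have := red_height x; rewrite xk rx pi => E.
  have [nu Hnu] := ipart_nat (cell_ofP xc.2).
  have : (i%:R : R) <= k%:R.
    by rewrite E lerDl sumr_ge0// => j _; rewrite Hnu ler0n.
  by rewrite ler_nat leqNgt ki.
have [e [inje Be]] := basis_enum bB.
pose s := (k - i)%N.
pose nu (t : d.+1.-tuple 'I_s.+1) : 'rV[R]_n :=
  \row_j (\sum_(c | e c == j) tnth t c)%N%:R.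
have nu_e t c : nu t 0 (e c) = (tnth t c)%:R.
  rewrite mxE (big_pred1 c)// => c'; exact: (inj_eq inje).
have nu_supp t : supported B (nu t).
  move=> j jB; rewrite mxE big1// => c /eqP ej; case/negP: jB.
  by rewrite Be -ej codom_f.
have nu_sum t : \sum_j nu t 0 j = (\sum_(c < d.+1) tnth t c)%N%:R.
  rewrite [in RHS](partition_big e xpredT)//= natr_sum; apply: eq_bigr => j _.
  by rewrite mxE.
pose f t := p + nu t *m A.
have finj : injective f.
  move=> t t' /addrI/eqP; rewrite -subr_eq0 -mulmxBl => /eqP/iB H.
  have {}H : nu t - nu t' = 0.
    by apply: H => j jB; rewrite mxE [X in _ + X]mxE !nu_supp ?subrr.
  apply: eq_from_tnth => c; apply: val_inj; apply/eqP; rewrite -(eqr_nat R).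
  by rewrite -!nu_e -subr_eq0; move/matrixP: H => /(_ 0 (e c)); rewrite mxE [X
    in _ + X]mxE => ->; rewrite mxE.
have f_cell t : in_cell A w q B (f t).
  split=> // j jB; rewrite coord_shift// mxE.
  have := HBp j jB; rewrite !lexposE; case: ifP => _ H.
    by rewrite addr_ge0// mxE.
  by rewrite ltr_pwDl// mxE.
have f_red t : red (f t) = p.
  rewrite /red (cell_of_eq (f_cell t)) /f.
  have nuE : nu t = \row_j ((\sum_(c | e c == j) tnth t c)%N : int)%:~R by [].
  by rewrite nuE ipart_shift -?nuE// ip0 add0r addrK.
have -> : [fset x in lattice_slice k | red x == p]%fset =
    (f @` [set t : d.+1.-tuple 'I_s.+1 | \sum_(c <- t) c == s]%N)%fset.
  apply/fsetP => x; apply/idP/imfsetP => [|[t]].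
    rewrite !inE => /andP[/in_slice[xc xk] /eqP rx].
    have HBx := cell_ofP xc.2.
    have xB : cell_of x = B by rewrite /B -rx; have [_ ->] := redP xc.
    have := red_height x; rewrite xk rx pi xB => E.
    have [m Hm] := ipart_nat HBx; rewrite xB in Hm.
    have Em : (\sum_j m j = s)%N.
      apply/eqP; rewrite -(eqr_nat R) /s natrB// E addrAC subrr add0r natr_sum.
      by apply/eqP/eq_bigr => j _; rewrite Hm.
    have mB j : j \notin B -> m j = 0%N.
      by move=> jB; apply/eqP; rewrite -(eqr_nat R) -Hm ipart_supp.
    have ms c : (m (e c) < s.+1)%N by rewrite ltnS -Em (bigD1 (e c))//=
      leq_addr.
    have [t Ht] : exists t : d.+1.-tuple 'I_s.+1, forall c, tnth t c = m (e c)
      :> nat.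
      by exists [tuple Ordinal (ms c) | c < d.+1] => c; rewrite tnth_mktuple.
    have nut : nu t = ipart B x.
      apply/rowP => j; rewrite Hm; have [|jB] := boolP (j \in B).
        by rewrite Be => /codomP[c ->]; rewrite nu_e Ht.
      by rewrite nu_supp// mB.
    exists t; last first.
      by rewrite /f nut -rx /red xB subrK.
    rewrite /= !inE big_tuple -(eqr_nat R) -nu_sum nut.
    rewrite -Em natr_sum; apply/eqP/eq_bigr => j _; exact: Hm.
  rewrite /= !inE big_tuple => /eqP ts ->; rewrite f_red eqxx andbT.
  apply/in_slice; split; [split; last exact: in_cell_cone (f_cell t)|].
    rewrite /f -[_ *m _]opprK; apply: int_sub => //; rewrite -mulNmx.
    apply: mulA_int; apply/mxOverP => ? j; rewrite !mxE rpredN; exact: natr_int.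
  by rewrite /f mxE height_mul// nu_sum ts pi -natrD subnKC.
rewrite card_imfset//= -[RHS](_ : 'C(d + s, d) = _); last by congr 'C(_, _);
  rewrite /s; lia.
rewrite -card_ord_partitions cardE; apply: perm_size.
apply: uniq_perm; rewrite ?enum_uniq ?undup_uniq// => t.
Qed.

(** Each lattice point lies over exactly one reduced point. The binomial
    coefficient is zero when [k < i]. *)
Lemma card_slice k :
  #|` lattice_slice k| = (\sum_(i < d.+1) hstar i * 'C(k + d - i, d))%N.
Proof.
rewrite card_fset_sum1.
transitivity (\sum_(x <- lattice_slice k) \sum_(p <- reduced | red x == p) 1)%N.
  rewrite big_seq_cond [RHS]big_seq_cond; apply: eq_bigr => x
    /andP[/in_slice[xc _] _].
  have rx : red x \in reduced.
    apply/in_reduced; have [rc Hc i0 HB] := redP xc; split; first exact: rc.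
    by apply/eqP; rewrite (red_eqP HB) i0.
  under eq_bigl do rewrite eq_sym.
  by rewrite sum1_count count_uniq_mem ?rx.
rewrite (exchange_big_dep xpredT)//=.
transitivity (\sum_(p <- reduced) \sum_(i < d.+1 | (p 0 0 == i%:R)%R) 'C(k + d
  - i, d))%N.
  rewrite big_seq_cond [RHS]big_seq_cond; apply: eq_bigr => p
    /andP[/in_reduced[pc rp] _].
  have [i pi] := height_nat pc.
  have id : (i < d.+1)%N by rewrite -(ltr_nat R) -pi reduced_height//; case: pc.
  rewrite [RHS](big_pred1 (Ordinal id)) => [|j]; last first.
    by rewrite pi eqr_nat; apply/eqP/eqP => [E|->//]; apply: val_inj; rewrite
      /= E.
  by rewrite -(card_fibre k pc rp pi id) card_fset_sum1 big_fset_condE.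
rewrite (exchange_big_dep xpredT)//=; apply: eq_bigr => i _.
by rewrite /hstar card_fset_sum1 big_fset_condE/= big_distrl/=; apply: eq_bigr
  => p _; rewrite mul1n.
Qed.

(** The only point of height 0 is the apex, which belongs to a single cell. *)
Lemma hstar0 : hstar 0 = 1%N.
Proof.
have c0 : int_cone 0.
  split; first by apply/mxOverP => i j; rewrite mxE rpred0.
  by exists 0; split; rewrite ?mul0mx// => j; rewrite mxE.
have HB := cell_ofP c0.2.
have r0 : red 0 = 0.
  have [[[_ sB] _] H] := HB; apply/eqP; rewrite (red_eqP HB); apply/eqP/rowP
    => j.
  rewrite mxE [RHS]mxE; case: ifP => // /H.
  by rewrite /coord mul0mx mxE /lexpos ltxx eqxx/= /part => ->; rewrite floor0.
rewrite /hstar (_ : [fset x in reduced | x 0 0 == 0%:R]%fset = [fset 0]%fset)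
  ?cardfs1//.
apply/fsetP => x; rewrite !inE/=; apply/andP/eqP => [[/in_reduced[[_ [u [u0
  xE]]] _] /eqP]|->].
  rewrite xE height_mul// => /eqP; rewrite psumr_eq0// => /allP u00.
  suff -> : u = 0 by rewrite mul0mx.
  by apply/rowP => j; rewrite mxE; apply/eqP/u00; rewrite mem_index_enum.
by split; [apply/in_reduced|rewrite mxE].
Qed.

End Counting.

(** * Reflected points and the inequality between the extreme h-numbers *)

Section InteriorPoints.
Variables (R : realType) (n d : nat) (A : 'M[R]_(n, d.+1)).
Variables (w : 'cV[R]_n) (tau : 'rV[R]_n).
Implicit Types (B S : {set 'I_n}) (u : 'rV[R]_n) (x y : 'rV[R]_d.+1).
Hypothesis A0 : forall j, A j 0 = 1.
Hypothesis Aint : A \is a mxOver Num.int.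
Hypothesis wgen : generic_cost A w.
Hypothesis tau0 : forall j, 0 < tau 0 j.
Hypothesis qgen : generic_dir A (tau *m A).
Hypothesis extremeA : forall j u, nonneg u -> u *m A = row j A -> u = delta_mx
  0 j.
Hypothesis d_gt0 : (0 < d)%N.

Notation hs := (hstar A w tau).
Notation q := (tau *m A).


Lemma cone0 : int_cone A 0.
Proof.
split; first by apply/mxOverP => i j; rewrite mxE rpred0.
by exists 0; split; rewrite ?mul0mx// => j; rewrite mxE.
Qed.

Lemma leq_card_rays : (d.+1 <= n)%N.
Proof.
have [[bB _] _] := cell_ofP A0 wgen tau0 qgen cone0.2.
by rewrite -(card_basis bB) -[X in (_ <= X)%N]card_ord max_card.
Qed.

(** The reflection of a reduced point in the centre of its parallelepiped: it
    changes the coordinates into their complements to 1, hence height [d] into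
    height 1. *)
Let flip x := (\row_j (j \in cell_of A w tau x)%:R : 'rV[R]_n) *m A - x.

(** Complementing to 1 exchanges the two kinds of half-open intervals, so that
    the reflected point belongs to the same cell for the opposite direction. *)
Let flip_in_cell x : cone A x -> red A w tau x = x ->
  in_cell A w (- q) (cell_of A w tau x) (flip x).
Proof.
move=> xc rx; have HB := cell_ofP A0 wgen tau0 qgen xc.
have rc := red_coord HB rx; set B := cell_of _ _ _ _ in HB rc *.
have [cB _] := HB; have [bB _] := cB; split=> // j jB.
have -> : coord A B (flip x) 0 j = 1 - coord A B x 0 j.
  rewrite /flip -/B coordB -(coord_uniq bB _ (erefl _)); last first.
    by move=> k /negbTE kB; rewrite mxE kB.
  by rewrite mxE [X in _ + X]mxE mxE jB.
have -> : coord A B (- q) 0 j = - coord A B q 0 j.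
  by rewrite /coord mulNmx mxE.
have := rc j jB; have := generic_dir_coord qgen bB jB; rewrite lexposE.
rewrite oppr_gt0 subr_ge0 subr_gt0 => q0.
have [qj|qj] := ltP 0 (coord A B q 0 j); first by rewrite (lt_gtF qj) =>
  /andP[].
by have -> : coord A B q 0 j < 0; [rewrite lt_neqAle q0|move=> /andP[]].
Qed.

Let flip_inj x y : cone A x -> red A w tau x = x -> cone A y -> red A w tau y
  = y ->
  flip x = flip y -> x = y.
Proof.
move=> xc rx yc ry; have := flip_in_cell xc rx; have := flip_in_cell yc ry.
move=> /[swap] + + E; rewrite E => H /(in_cell_uniq H) EB.
by move: E; rewrite /flip EB => /addrI/oppr_inj.
Qed.

(** A reflected point is still in the cone after subtracting a small multiple
    of [q], so it has a representation with all weights positive; a generator,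
    being extreme, has none. *)
Let flip_not_ray x j : cone A x -> red A w tau x = x -> flip x <> row j A.
Proof.
move=> xc rx E; have HB := flip_in_cell xc rx.
set B := cell_of _ _ _ _ in HB; have [cB H] := HB; have [bB _] := cB.
have [_ sB] := bB.
have [e e0 He] := lexpos_small (fun k => coord A B (flip x) 0 k)
   (fun k => coord A B (- q) 0 k).
have {}He := He e; rewrite e0 lexx in He; have {}He := He isT.
pose k := coord A B (flip x + e *: - q).
have k0 : nonneg k.
  move=> i; have [iB|iB] := boolP (i \in B); last by rewrite (coord_supp _ sB).
  by apply: ltW; rewrite /k coordDZ He H.
have kA : (k + e *: tau) *m A = row j A.
  by rewrite mulmxDl coordK// -scalemxAl scalerN addrNK E.
have ke : nonneg (k + e *: tau).
  move=> i; rewrite mxE [X in _ + X]mxE addr_ge0// mulr_ge0 ?ltW//.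
have /matrixP Ej := extremeA ke kA.
have [i ij] : exists i, i != j.
  apply/existsP; apply: contraT; rewrite negb_exists => /forallP H1.
  have : (#|'I_n| <= 1)%N.
    by apply/fintype_le1P => a b; move/negPn/eqP: (H1 a) => ->; apply/eqP/negPn.
  by rewrite card_ord leqNgt (leq_trans _ leq_card_rays).
have := Ej 0 i; rewrite [in RHS]mxE eqxx (negbTE ij) mxE [X in _ + X]mxE =>
  /eqP.
by rewrite gt_eqF// ltr_wpDl ?k0 ?mulr_gt0.
Qed.

Let ray_cone j : int_cone A (row j A) /\ (row j A) 0 0 = 1%:R.
Proof.
split; last by rewrite mxE A0.
split; first by apply/mxOverP => i c; rewrite mxE; exact: (mxOverP Aint).
exists (delta_mx 0 j); split; last by rewrite rowE.
by move=> i; rewrite mxE ler0n.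
Qed.

(** The reflected points and the generators are distinct lattice points of
    height 1. *)
Lemma hstar_top_slice : (hs d + d.+1 <= #|` lattice_slice A 1|)%N.
Proof.
pose F := [fset flip x | x in [fset x in reduced A w tau | x 0 0 == d%:R]]%fset.
pose G := [fset row j A | j in 'I_n]%fset.
have Fin x : x \in [fset x in reduced A w tau | x 0 0 == d%:R]%fset ->
    [/\ int_cone A x, red A w tau x = x & x 0 0 = d%:R].
  by rewrite !inE/= => /andP[/(in_reduced A0 wgen tau0 qgen)[xc rx] /eqP].
have cF : #|` F| = hs d.
  rewrite card_in_imfset// => x y /Fin[[_ xc] rx _] /Fin[[_ yc] ry _].
  exact: flip_inj.
have cG : #|` G| = n.
  rewrite card_imfset /= ?size_enum_ord//; last first.
    move=> i j E; have d0 : nonneg (delta_mx 0 i : 'rV[R]_n).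
      by move=> k; rewrite mxE ler0n.
    have := extremeA d0 (etrans (esym (rowE i A)) E).
    move=> /matrixP/(_ 0 i); rewrite !mxE !eqxx/= => /eqP.
    by case: (eqVneq i j) => //= _; rewrite ?mulr0n oner_eq0.
have FG : [disjoint F & G]%fset.
  apply/fdisjointP => y /imfsetP[x /= /Fin[[_ xc] rx _] ->].
  by apply/imfsetP => -[j _]; apply: flip_not_ray.
have FGS : (F `|` G `<=` lattice_slice A 1)%fset.
  apply/fsubsetP => y; rewrite inE => /orP[|] /imfsetP[x /= xin ->];
    apply/in_slice => //.
  have [[xi xc] rx xd] := Fin _ xin; have HB := flip_in_cell xc rx.
  set B := cell_of _ _ _ _ in HB; have [[bB _] _] := HB.
  split; last first.
    rewrite mxE [X in _ + X]mxE xd height_mul//.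
    under eq_bigr do rewrite mxE.
    by rewrite -natr_sum -big_mkcond/= sum1_card (card_basis bB) -natrB
      ?leqnSn// subSnn.
  split; last by exists (coord A B (flip x)); split; [exact: in_cell_coord HB
    | rewrite coordK//; case: bB].
  apply: int_sub => //; apply: mulA_int => //; apply/mxOverP => i j.
  by rewrite mxE natr_int.
apply: leq_trans (fsubset_leq_card FGS).
have := cardfsUI F G; have /eqP-> : (F `&` G == fset0)%fset by rewrite
  fsetI_eq0.
rewrite cardfs0 addn0 cF cG => ->.
by rewrite leq_add2l leq_card_rays.
Qed.

Lemma hstar_top_le : (hs d <= hs 1)%N.
Proof.
have sum1 m (h : nat -> nat) : (0 < m)%N ->
    (\sum_(i < m.+1) h i * 'C(1 + m - i, m) = h 0 * m.+1 + h 1)%N.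
  case: m => // m _; rewrite big_ord_recl big_ord_recl big1 => [|i _].
    rewrite addn0 /= /bump /= !addn0 !add1n subn0 subSS subn0.
    by rewrite binn muln1 binSn.
  by rewrite bin_small ?muln0// /bump /= !add1n !subSS; apply: leq_ltn_trans
    (leq_subr _ _) _.
have := hstar_top_slice; rewrite (card_slice A0 Aint wgen tau0 qgen).
by rewrite (sum1 d (hs))// hstar0// mul1n addnC leq_add2l.
Qed.

End InteriorPoints.

(** * The binomial basis and the coefficients of shifted factorials *)

Section Polynomials.

(** The polynomial [d! 'C(X + i, d)], whose coefficients are the [Ccoef d r
    i]. *)
Definition shifted_ffact (R : comNzRingType) (d : nat) (i : int) : {poly R} :=
  \prod_(j < d) ('X + ((i - j%:Z)%:~R)%:P).

Lemma Ccoef_intr (R : comNzRingType) d r (i : int) :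
  (Ccoef d r i)%:~R = (shifted_ffact R d i)`_r.
Proof.
rewrite /Ccoef /shifted_ffact -(coef_map (intr : int -> R)) rmorph_prod; congr
  (nth 0 (polyseq _) r).
by apply: eq_bigr => j _; rewrite rmorphD/= map_polyX map_polyC.
Qed.

Lemma shifted_ffact_monic (R : comNzRingType) d i :
  shifted_ffact R d i \is monic.
Proof. by apply: monic_prod => j _; exact: monicXaddC. Qed.

Lemma size_shifted_ffact (R : idomainType) d i : size (shifted_ffact R d i) =
  d.+1.
Proof.
rewrite size_prod => [|j _]; last exact/monic_neq0/monicXaddC.
under eq_bigr do rewrite size_XaddC.
by rewrite sum_nat_const cardT size_enum_ord; lia.
Qed.

(** For [N < m] both sides vanish, although the factors of the left-hand side
    are truncated. *)
Lemma ffactR (R : comNzRingType) (N m : nat) :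
  (N ^_ m)%:R = \prod_(j < m) (N%:R - j%:R) :> R.
Proof.
elim: m => [|m IH]; first by rewrite ffactn0 big_ord0.
rewrite ffactnSr natrM IH big_ord_recr/=.
have [mN|Nm] := leqP m N; first by rewrite natrB.
by rewrite -IH ffact_small// !mul0r.
Qed.

Lemma horner_shifted_ffact (R : comNzRingType) d k i : (i <= d)%N ->
  (shifted_ffact R d (d - i)%N%:Z).[k%:R] = (d`! * 'C(k + d - i, d))%:R.
Proof.
move=> id; rewrite mulnC bin_ffact ffactR horner_prod; apply: eq_bigr => j _.
by rewrite hornerD hornerX hornerC -addnBA// natrD intrB -!pmulrn addrA.
Qed.

Lemma binomial_basis (R : realFieldType) d (h : nat -> nat) (g : {poly R}) :
  (forall k, (0 < k)%N -> g.[k%:R] = (\sum_(i < d.+1) h i * 'C(k + d - i,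
    d))%N%:R) ->
  g = (d`!%:R)^-1 *: \sum_(i < d.+1) (h i)%:R *: shifted_ffact R d (d - i)%N%:Z.
Proof.
move=> gh; apply: eq_poly_nat => k k0; rewrite gh// hornerZ horner_sum.
rewrite natr_sum mulr_sumr; apply: eq_bigr => i _.
by rewrite hornerZ horner_shifted_ffact -1?ltnS// !natrM mulrCA mulKf.
Qed.

Lemma binomial_basis_coef (R : realFieldType) d (h : nat -> nat) (g : {poly
  R}) r :
  (forall k, (0 < k)%N -> g.[k%:R] = (\sum_(i < d.+1) h i * 'C(k + d - i,
    d))%N%:R) ->
  g`_r = (d`!%:R)^-1 * (\sum_(i < d.+1) (h i)%:Z * Ccoef d r (d - i)%N%:Z)%:~R.
Proof.
move=> /binomial_basis->; rewrite coefZ coef_sum rmorph_sum; congr (_ * _).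
by apply: eq_bigr => i _; rewrite coefZ rmorphM/= -Ccoef_intr.
Qed.

Lemma binomial_basis_top (R : realFieldType) d (h : nat -> nat) (g : {poly R}) :
  (forall k, (0 < k)%N -> g.[k%:R] = (\sum_(i < d.+1) h i * 'C(k + d - i,
    d))%N%:R) ->
  (size g <= d.+1)%N /\ d`!%:R * g`_d = (\sum_(i < d.+1) h i)%N%:R.
Proof.
move=> gh; split.
  rewrite (binomial_basis gh) (leq_trans (size_scale_leq _ _))//.
  apply: (leq_trans (size_sum _ _ _)); apply/bigmax_leqP => i _.
  by rewrite (leq_trans (size_scale_leq _ _))// size_shifted_ffact.
rewrite (binomial_basis gh) coefZ mulVKf ?pnatr_eq0 -?lt0n ?fact_gt0//.
rewrite coef_sum natr_sum; apply: eq_bigr => i _; rewrite coefZ.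
have /monicP := shifted_ffact_monic R d (d - i)%N%:Z.
by rewrite lead_coefE size_shifted_ffact /= => ->; rewrite mulr1.
Qed.

Lemma coef_comp_polyN (R : comNzRingType) (p : {poly R}) r :
  (p \Po (- 'X))`_r = (-1) ^+ r * p`_r.
Proof.
rewrite comp_polyE coef_sum.
have E (i : 'I_(size p)) : (p`_i *: (- 'X) ^+ i)`_r = if r == i then (-1) ^+ r
  * p`_r else 0.
  rewrite coefZ -scaleN1r exprZn coefZ coefXn.
  by case: eqP => [->|_]; rewrite ?mulr0// mulr1 mulrC.
under eq_bigr do rewrite E.
have [rp|pr] := ltnP r (size p).
  by rewrite (bigD1 (Ordinal rp))//= eqxx big1 ?addr0// => i; rewrite
    -val_eqE/= eq_sym => /negbTE->.
by rewrite nth_default// mulr0 big1// => i _; case: eqP.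
Qed.

Lemma coef_prod_opp (R : comNzRingType) d (c : nat -> R) r :
  (\prod_(j < d) ('X + (c j)%:P) : {poly R})`_r =
  (-1) ^+ (d + r) * (\prod_(j < d) ('X - (c j)%:P) : {poly R})`_r.
Proof.
rewrite exprD -mulrA -coef_comp_polyN -coefZ; congr (nth 0 (polyseq _) r).
elim: d => [|d IH]; first by rewrite !big_ord0 comp_polyC expr0 scale1r.
rewrite !big_ord_recr/= IH comp_polyM comp_polyB comp_polyX comp_polyC exprSr.
by rewrite -scalerA -scalerAl scaleN1r -mulrN opprB opprK addrC.
Qed.

(** The product for [d - 1 - i] has the opposite roots of the product for [i]. *)
Lemma Ccoef_sym d r (i : int) :
  Ccoef d r (d%:Z - 1 - i) = (-1) ^+ (d + r) * Ccoef d r i.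
Proof.
rewrite /Ccoef (reindex_inj rev_ord_inj)/=.
rewrite (eq_bigr (fun j : 'I_d => 'X + (j%:Z - i)%:P)); last first.
  by move=> j _; congr (_ + _%:P); have := ltn_ord j; lia.
rewrite (coef_prod_opp _ (fun j => j%:Z - i)); congr (_ * nth 0 (polyseq _) r).
by apply: eq_bigr => j _; rewrite -polyCN opprB.
Qed.

Lemma Ccoef_top d r : (r <= d)%N ->
  Ccoef d r d = (-1) ^+ (d - r) * stirl d.+1 r.+1.
Proof.
move=> rd; have -> : (-1) ^+ (d - r) = (-1) ^+ (d + r) :> int.
  by rewrite -signr_odd oddB// -oddD signr_odd.
rewrite /stirl big_ord_recl subr0 coefXM /= /Ccoef (reindex_inj rev_ord_inj)/=.
rewrite (eq_bigr (fun j : 'I_d => 'X + j.+1%:Z%:P)); last first.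
  by move=> j _; congr (_ + _%:P); have := ltn_ord j; lia.
by rewrite (coef_prod_opp _ (fun j => j.+1%:Z)).
Qed.

Lemma coef_prod_ge0 m (c : nat -> nat) r :
  0 <= (\prod_(j < m) ('X + (c j)%:Z%:P) : {poly int})`_r.
Proof.
elim: m r => [|m IH] r; first by rewrite big_ord0 coef1 ler0n.
rewrite big_ord_recr/= mulrDr coefD coefMX coefMC addr_ge0 ?mulr_ge0//.
by case: eqP.
Qed.

Lemma Ccoef_pred_ge0 d r : 0 <= Ccoef d.+1 r d.
Proof.
rewrite /Ccoef (reindex_inj rev_ord_inj)/=.
rewrite (eq_bigr (fun j : 'I_d.+1 => 'X + j%:Z%:P)); first exact:
  (coef_prod_ge0 d.+1 id).
by move=> j _; congr (_ + _%:P); have := ltn_ord j; lia.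
Qed.

(** Both products contain [X (X + 1) ... (X + d)], which has nonnegative
    coefficients; the remaining factors are [X - 1] and [X + d + 1]. *)
Lemma Ccoef_pred2_le d r : Ccoef d.+2 r d%:Z <= Ccoef d.+2 r d.+1%:Z.
Proof.
pose Q : {poly int} := \prod_(j < d.+1) ('X + (d%:Z - j%:Z)%:P).
have E1 : \prod_(j < d.+2) ('X + (d%:Z - j%:Z)%:P) =
    Q * ('X + d.+1%:Z%:P) - Q * d.+2%:Z%:P.
  rewrite big_ord_recr/= -mulrBr -addrA -polyCN -polyCD; congr (_ * ('X +
    _%:P)); lia.
have E2 : \prod_(j < d.+2) ('X + (d.+1%:Z - j%:Z)%:P) = Q * ('X + d.+1%:Z%:P).
  rewrite big_ord_recl subr0 mulrC; congr (_ * _); apply: eq_bigr => j _.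
  by congr (_ + _%:P); rewrite /= /bump; lia.
rewrite /Ccoef E1 E2 coefB lerBlDr lerDl coefMC mulr_ge0//.
exact: Ccoef_pred_ge0.
Qed.

Lemma Mmin_le r d i : (0 < i < d.-1)%N -> Mmin r d <= Ccoef d r i%:Z.
Proof.
move=> /andP[i0 id]; rewrite /Mmin.
by apply: (bigmin_inf_seq _ i) => //; rewrite mem_index_iota i0.
Qed.

(** The terms [i = 1] and [i = d] fall outside the range of the minimum and are
    treated together. *)
Lemma hstar_bound d r (h : nat -> nat) : (2 < d)%N -> (r <= d)%N ->
  h 0%N = 1%N -> (h d <= h 1)%N ->
  (-1) ^+ (d - r) * stirl d.+1 r.+1 +
    ((\sum_(i < d.+1) h i)%N%:Z - 1) * Mmin r d
  <= \sum_(i < d.+1) (h i)%:Z * Ccoef d r (d - i)%N%:Z.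
Proof.
move=> d2 rd h0 hd1; rewrite -Ccoef_top//.
have H i : (1 < i < d)%N -> (h i)%:Z * Mmin r d <= (h i)%:Z * Ccoef d r (d -
  i)%N%:Z.
  by move=> id; rewrite ler_wpM2l// Mmin_le//; lia.
set M := Mmin r d in H *.
case: d d2 rd hd1 @M H => [|[|d]]// d2 rd hd1 M H.
have ends : ((h 1)%:Z + (h d.+2)%:Z) * M <=
            (h 1)%:Z * Ccoef d.+2 r d.+1%:Z + (h d.+2)%:Z * Ccoef d.+2 r 0%:Z.
  have s0 := Ccoef_pred_ge0 d.+1 r.
  have MC : M <= Ccoef d.+2 r d by apply: Mmin_le; lia.
  have Ms := le_trans MC (Ccoef_pred2_le d r).
  have M1 : M <= Ccoef d.+2 r 1%:Z by apply: Mmin_le; lia.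
  have := Ccoef_sym d.+2 r 0; have := Ccoef_sym d.+2 r 1.
  rewrite (_ : d.+2%:Z - 1 - 0 = d.+1%:Z); last by lia.
  rewrite (_ : d.+2%:Z - 1 - 1 = d%:Z); last by lia.
  have : (h d.+2)%:Z <= (h 1)%:Z by [].
  (* If the sign is positive, both extreme coefficients are equal and at
     least M. If it is negative, they are opposite, and M is nonpositive
     since it bounds below the coefficients at both ends of its range,
     which are opposite too. *)
  have [->|->] : (-1) ^+ (d.+2 + r) = 1 :> int \/
      (-1) ^+ (d.+2 + r) = -1 :> int.
    by rewrite -signr_odd; case: odd; [right|left].
    rewrite !mul1r mulrDl => _ _ <-.
    by rewrite lerD// ler_wpM2l.
  move: MC Ms M1 s0; rewrite !mulN1r.
  move: (Ccoef d.+2 r 0%:Z) (Ccoef d.+2 r 1%:Z) (Ccoef d.+2 r d%:Z) (Ccoef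
    d.+2 r d.+1%:Z) => c0 c1 cd cD MC Ms M1 s0 hh E1 E0.
  have M0 : M <= 0 by lia.
  apply: (@le_trans _ _ 0); first by rewrite mulr_ge0_le0.
  have -> : c0 = - cD by rewrite E0 opprK.
  by rewrite mulrN -mulrBl mulr_ge0// subr_ge0.
have split3 (f : nat -> int) :
    \sum_(i < d.+3) f i = f 0%N + (f 1%N + f d.+2 + \sum_(i < d) f i.+2).
  rewrite big_ord_recl big_ord_recl big_ord_recr/= -addrA; congr (_ + (_ + _)).
  by rewrite addrC; congr (_ + _); apply: eq_bigr => i _; congr f.
have -> : (\sum_(i < d.+3) h i)%N%:Z = \sum_(i < d.+3) (h i)%:Z.
  by rewrite -natz natr_sum; apply: eq_bigr => i _; rewrite natz.
rewrite (split3 (fun i => (h i)%:Z)) (split3 (fun i => (h i)%:Z * Ccoef d.+2 r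
  (d.+2 - i)%N%:Z)).
rewrite h0 subn0 mul1r lerD2l addrAC subrr add0r mulrDl.
apply: lerD; first by rewrite subSS subn0 subnn.
rewrite mulr_suml; apply: ler_sum => i _; apply: H.
by have := ltn_ord i; lia.
Qed.

End Polynomials.

(** * Comparing top coefficients and counting integer points of boxes *)

Section BoxCounting.
Variable R : realType.

(** Comparing values at large integers compares coefficients of the top degree:
    at [k] a difference [r] of degree [d + 1] is at least
    [k ^ d * (r_(d+1) * k - S)] for [S] the sum of the other coefficients in
    absolute value. *)
Lemma le_top_coef d (p q : {poly R}) (K : nat) :
  (size p <= d.+2)%N -> (size q <= d.+2)%N ->
  (forall k, (K < k)%N -> p.[k%:R] <= q.[k%:R]) -> p`_d.+1 <= q`_d.+1.
Proof.
move=> sp sq pq; rewrite leNgt; apply/negP => qp.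
pose r := p - q; have r0 : 0 < r`_d.+1 by rewrite coefB subr_gt0.
have sr : (size r <= d.+2)%N.
  by rewrite (leq_trans (size_polyD _ _))// geq_max sp size_polyN.
pose S := \sum_(i < d.+1) `|r`_i|.
pose k := (maxn K (Num.truncn (S / r`_d.+1))).+1.
have k0 : 0 < k%:R :> R by rewrite ltr0n.
have kS : S < r`_d.+1 * k%:R.
  rewrite mulrC -ltr_pdivrMr//; apply: lt_le_trans (truncnS_gt _) _.
  by rewrite ler_nat ltnS leq_maxr.
have : r.[k%:R] <= 0.
  by rewrite hornerD hornerN subr_le0 pq// ltnS leq_maxl.
apply/negP; rewrite -ltNge (horner_coef_wide _ sr) big_ord_recr/=.
rewrite -ltrBlDl sub0r -sumrN; apply: le_lt_trans (_ : S * k%:R ^+ d < _).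
  rewrite mulr_suml; apply: ler_sum => i _.
  rewrite (le_trans (ler_norm _))// normrN normrM ler_wpM2l// normrX ger0_norm
    ?ler0n//.
  by rewrite ler_weXn2l ?ler1n// -ltnS.
by rewrite exprS mulrA ltr_pM2r// exprn_gt0.
Qed.

Lemma coef_prod_linear (d : nat) (c e : 'I_d -> R) :
  let p := \prod_i ((c i)%:P * 'X + (e i)%:P) in
  (size p <= d.+1)%N /\ p`_d = \prod_i c i.
Proof.
elim: d c e => [|d IH] c e /=; first by rewrite !big_ord0 size_poly1 coef1.
rewrite !big_ord_recl; have [] := IH (fun i => c (lift ord0 i)) (fun i => e
  (lift ord0 i)).
set p := \prod_(i < d) _ => sp pd.
have s1 : (size ((c ord0)%:P * 'X + (e ord0)%:P : {poly R})%R <= 2)%N.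
  by rewrite size_MXaddC; case: ifP => // _; rewrite ltnS size_polyC; case: eqP.
split.
  by apply: leq_trans (size_polyMleq _ _) _; have := leq_add s1 sp; lia.
rewrite mulrDl -mulrA coefD !coefCM coefXM /= pd [X in _ + _ * X]nth_default
  ?mulr0 ?addr0//.
Qed.

Lemma prod_enlarge (d : nat) (l : 'I_d -> R) (del : R) : 0 < del ->
  exists2 eta : R, 0 < eta & \prod_i (l i + eta + eta) <= \prod_i l i + del.
Proof.
move=> del0; pose p := \prod_i ('X + 'X + (l i)%:P : {poly R}).
have pE x : p.[x] = \prod_i (l i + x + x).
  rewrite horner_prod; apply: eq_bigr => i _.
  by rewrite !hornerE addrC addrA.
have /cvgrPdist_le/(_ _ del0) := @continuous_horner R p 0.
case/nbhs_ballP => e /= e0 He; exists (e / 2); first by rewrite divr_gt0.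
have := He (e / 2); rewrite /ball /= sub0r normrN gtr0_norm ?divr_gt0//.
have eh : e / 2 < e by rewrite ltr_pdivrMr// ltr_pMr// ltr1n.
move=> /(_ eh).
rewrite !pE ler_distl => /andP[+ _]; rewrite lerBlDr.
by under [X in _ <= X + _]eq_bigr do rewrite !addr0.
Qed.

(** An interval from [al] to [be] has at most [be - al + 1] integers, also
    when it contains none, as [al <= be]. *)
Lemma card_int_box (d : nat) (al be : 'I_d -> R) (X : {fset 'rV[R]_d}) :
  (forall x, x \in X -> x \is a mxOver Num.int /\
    forall i, al i <= x 0 i <= be i) ->
  (forall i, al i <= be i) ->
  #|` X|%:R <= \prod_i (be i - al i + 1).
Proof.
move=> XP ab.
pose N i := (absz (Num.floor (be i) - Num.ceil (al i) + 1)).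
have Nle i : (N i)%:R <= be i - al i + 1.
  have fl := floor_le (be i); have ce := ceil_ge (al i).
  have : (-1 : int) < Num.floor (be i) - Num.ceil (al i) + 1.
    have c1 := ceilB1_lt (al i); have f1 := floorD1_gt (be i).
    have : (Num.ceil (al i) - 1)%:~R < (Num.floor (be i) + 1)%:~R :> R.
      by apply: lt_trans c1 (le_lt_trans (ab i) f1).
    by rewrite ltr_int; lia.
  move=> N0; rewrite -[(N i)%:R]/((N i)%:Z%:~R) /N gez0_abs; last by lia.
  by rewrite !intrD mulrNz lerD2r lerD// lerN2.
pose M := (\max_i N i)%N.
pose f (x : 'rV[R]_d) : {ffun 'I_d -> 'I_M.+1} :=
  [ffun i => inord (absz (Num.floor (x 0 i) - Num.ceil (al i))%R)].
have xE x i : x \in X -> exists z : int, [/\ x 0 i = z%:~R,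
    (0 <= z - Num.ceil (al i))%R & (absz (z - Num.ceil (al i))%R < N i)%N].
  move=> /XP[/mxOverP/(_ 0 i)/intrP[z xz] /(_ i)]; rewrite xz => /andP[z1 z2].
  exists z; have : Num.ceil (al i) <= z by rewrite ceil_le_int.
  have : z <= Num.floor (be i) by rewrite floor_ge_int.
  by rewrite /N; split=> //; lia.
have fE (x : 'rV[R]_d) i (z : int) : x 0 i = z%:~R -> (absz (z - Num.ceil (al
  i))%R < N i)%N ->
    f x i = absz (z - Num.ceil (al i))%R :> nat.
  move=> xz zN; rewrite ffunE xz intrKfloor inordK// ltnS.
  by rewrite ltnW// (leq_trans zN)// leq_bigmax.
have finj : {in X &, injective f}.
  move=> x y xX yX /ffunP E; apply/rowP => i.
  have [z [xz z0 zN]] := xE _ i xX; have [t [yt t0 tN]] := xE _ i yX.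
  have := E i => /(congr1 val) /=; rewrite (fE _ _ _ xz zN) (fE _ _ _ yt tN)
    => zt.
  by rewrite xz yt; congr (_%:~R); lia.
have : (#|` X| <= \prod_i N i)%N.
  have -> : (\prod_i N i = #|family (fun i => [pred k : 'I_M.+1 | (k < N
    i)%N])|)%N.
    rewrite -sum1_card.
    transitivity (\prod_i \sum_(k < M.+1 | (k < N i)%N) 1)%N.
      apply: eq_bigr => i _; rewrite -(big_ord_widen M.+1 (fun=> 1%N)).
        by rewrite sum_nat_const card_ord muln1.
      by rewrite ltnW// ltnS leq_bigmax.
    rewrite bigA_distr_big_dep/=; apply: eq_big => // g _.
    by rewrite big1.
  rewrite cardE -(size_map f); apply: uniq_leq_size.
    by rewrite map_inj_in_uniq ?fset_uniq.
  move=> _ /mapP[x xX ->]; rewrite mem_enum; apply/familyP => i.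
  by rewrite inE; have [z [xz z0 zN]] := xE _ i xX; rewrite (fE _ _ _ xz zN).
rewrite -(ler_nat R) => /le_trans; apply.
by rewrite natr_prod; apply: ler_prod => i _; rewrite ler0n Nle.
Qed.

End BoxCounting.

(** * Compactness of hulls *)

Section HullTopology.
Local Open Scope classical_set_scope.
Import numFieldNormedType.Exports.
Variables (R : realType) (n d : nat).

Definition hull (m : nat) (V : 'M[R]_(n, m)) : set 'rV[R]_m :=
  [set v | exists u : 'rV[R]_n, [/\ nonneg u, \sum_j u 0 j = 1 & v = u *m V]].

Lemma dilate_hullP (m : nat) (V : 'M[R]_(n, m)) (k : nat) y : (0 < k)%N ->
  dilate k (hull V) y <->
  exists u : 'rV[R]_n, [/\ nonneg u, \sum_j u 0 j = k%:R & y = u *m V].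
Proof.
move=> k0; have kR : k%:R != 0 :> R by rewrite pnatr_eq0 -lt0n.
split=> [[x [u [u0 u1 ->]] <-]|[u [u0 u1 ->]]].
  exists (k%:R *: u); split; last by rewrite scalemxAl.
  - by move=> j; rewrite mxE mulr_ge0 ?ler0n// u0.
  - by under eq_bigr do rewrite mxE; rewrite -mulr_sumr u1 mulr1.
exists (k%:R^-1 *: u *m V); last by rewrite -scalemxAl scalerA divff// scale1r.
exists (k%:R^-1 *: u); split=> //.
- by move=> j; rewrite mxE mulr_ge0 ?invr_ge0 ?ler0n// u0.
- by under eq_bigr do rewrite mxE; rewrite -mulr_sumr u1 mulVf.
Qed.

Lemma continuous_mulmxr (m : nat) (V : 'M[R]_(n, m)) :
  continuous (fun u : 'rV[R]_n => u *m V).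
Proof.
have sumc (c : 'I_n -> R) (r : seq 'I_n) :
    continuous (fun u : 'rV[R]_n => \sum_(j <- r) u 0 j * c j).
  elim: r => [|j r IH] u.
    rewrite (_ : (fun _ => _) = cst 0); first exact: cst_continuous.
    by apply/funext => u'; rewrite big_nil.
  rewrite (_ : (fun _ => _) = (fun u' : 'rV[R]_n => u' 0 j * c j) \+
    (fun u' : 'rV[R]_n => \sum_(j <- r) u' 0 j * c j)); last first.
    by apply/funext => u'; rewrite big_cons.
  apply: continuousD; last exact: IH.
  apply: (@continuousM _ _ (fun u' : 'rV[R]_n => u' 0 j) (cst (c j))).
    exact: coord_continuous.
  exact: cst_continuous.
move=> u S [Q HQ QS]; change (nbhs u ((fun u' => u' *m V) @^-1` S)).
have H c : \forall u' \near u, Q 0 c ((u' *m V) 0 c).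
  have cu := sumc (fun j => V j c) (index_enum _) u.
  have Hq : nbhs (\sum_j u 0 j * V j c) (Q 0 c) by have := HQ 0 c; rewrite mxE.
  have : nbhs u (fun u' : 'rV[R]_n => Q 0 c (\sum_j u' 0 j * V j c)) := cu _ Hq.
  by apply: filterS => u'; rewrite mxE.
have : \forall u' \near u, forall c, Q 0 c ((u' *m V) 0 c).
  exact: (@filter_forall _ _ (fun c (u' : 'rV[R]_n) => Q 0 c ((u' *m V) 0 c))
    (nbhs u) _ H).
apply: filterS => u' Hu'; apply: QS => i c; rewrite ord1; exact: Hu'.
Qed.

Lemma compact_hull (V : 'M[R]_(n, d)) : compact (hull V).
Proof.
pose D := [set u : 'rV[R]_n | nonneg u /\ \sum_j u 0 j = 1].
have -> : hull V = (fun u => u *m V) @` D.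
  apply/seteqP; split=> x.
    by move=> [u [u0 u1 ->]]; exists u.
  by move=> [u [u0 u1] <-]; exists u.
apply: continuous_compact; first exact/continuous_subspaceT/continuous_mulmxr.
apply: bounded_closed_compact.
  exists 1; split=> // M M1 u [u0 u1] /=.
  rewrite [leLHS]/Num.Def.normr /= mx_normrE; apply/bigmax_leP; split=> [|[i
    j] _ /=].
    by apply: ltW; apply: lt_trans M1.
  rewrite ord1 ger0_norm// (le_trans _ (ltW M1))// -u1 (bigD1 j)//= lerDl.
  by rewrite sumr_ge0.
have -> : D = \bigcap_j [set u : 'rV[R]_n | 0 <= u 0 j] `&`
              [set u | (u *m (const_mx 1 : 'cV[R]_n)) 0 0 = 1].
  apply/seteqP; split=> u.
    move=> [u0 u1]; split; first by move=> j _; exact: u0.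
    by rewrite /= mxE -[RHS]u1; apply: eq_bigr => j _; rewrite mxE mulr1.
  move=> [u0 u1]; split; first by move=> j; exact: u0.
  by rewrite -[RHS]u1 mxE; apply: eq_bigr => j _; rewrite mxE mulr1.
apply: closedI.
  apply: closed_bigI => j _.
  apply: (@preimage_closed _ _ (fun u : 'rV[R]_n => u 0 j) [set x | 0 <= x]).
    by move=> u _; exact: coord_continuous.
  exact: closed_ge.
apply: (@preimage_closed _ _ (fun u : 'rV[R]_n => (u *m (const_mx 1 :
  'cV[R]_n)) 0 0) [set x | x = 1]).
  move=> u _; apply: (@continuous_comp _ _ _ (fun u' : 'rV[R]_n => u' *m
    (const_mx 1 : 'cV[R]_n)) (fun v : 'rV[R]_1 => v 0 0)).
    exact: continuous_mulmxr.
  exact: coord_continuous.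
exact: closed_eq.
Qed.

Lemma open_box (a b : 'rV[R]_d) : open [set x : 'rV[R]_d | forall i, a 0 i < x
  0 i < b 0 i].
Proof.
rewrite openE => x /= H.
exists (fun i j => [set y | a 0 j < y < b 0 j]) => [i j /=|y /= Hy j]; last
  exact: Hy.
have -> : [set y | a 0 j < y < b 0 j] = `]a 0 j, b 0 j[%classic.
  by apply/seteqP; split=> y; rewrite /= in_itv/=.
by apply: open_nbhs_nbhs; split; [exact: itv_open|rewrite /= in_itv/= ord1;
  exact: H].
Qed.

End HullTopology.

(** * Volume: lower bound for covers by boxes *)

Section VolumeBounds.
Local Open Scope classical_set_scope.
Import numFieldNormedType.Exports.
Variables (R : realType) (n d : nat) (V : 'M[R]_(n, d.+1)) (g : {poly R}).
Hypothesis size_g : (size g <= d.+2)%N.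
Hypothesis ehrhart_g : is_ehrhart_poly (hull V) g.

Lemma finite_int_dilate k : (0 < k)%N ->
  finite_set (dilate k (hull V) `&` @int_points R d.+1).
Proof.
move=> k0; pose N := Num.truncn (\sum_c (k%:R * \sum_j `|V j c|)).
apply: sub_finite_set (finite_bounded_int R d.+1 N.+1) => y.
move=> [/(dilate_hullP V y k0)[u [u0 u1 ->]] yi]; split=> // c.
rewrite (le_trans _ (ltW (truncnS_gt _)))// (bigD1 c)//= ler_wpDr//.
  by apply: sumr_ge0 => i _; rewrite mulr_ge0// sumr_ge0.
rewrite mxE (le_trans (ler_norm_sum _ _ _))// mulr_sumr ler_sum// => j _.
rewrite normrM (ger0_norm (u0 j)) ler_wpM2r// -u1.
by rewrite (bigD1 j)//= lerDl sumr_ge0.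
Qed.

Lemma sum_fset_le_series (D : {fset nat}) (f : nat -> R) : (forall m, 0 <= f
  m) ->
  ((\sum_(m <- D) f m)%:E <= \sum_(0 <= m <oo) (f m)%:E)%E.
Proof.
move=> f0; pose N := (\max_(m <- D) m).+1.
apply: le_trans (nneseries_lim_ge N _); last by move=> m _ _; rewrite lee_fin.
rewrite sumEFin lee_fin.
have -> : \sum_(m <- D) f m = \sum_(0 <= m < N | m \in D) f m.
  rewrite -[RHS]big_filter; apply: perm_big; apply: uniq_perm.
  - exact: fset_uniq.
  - by rewrite filter_uniq// iota_uniq.
  move=> m; rewrite mem_filter mem_index_iota /=; case: (boolP (m \in D)) =>
    //= mD.
  by rewrite /N ltnS (bigD1_seq m)//= ?leq_maxl// fset_uniq.
by rewrite big_mkcond/=; apply: ler_sum => m _; case: ifP.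
Qed.

(** Enlarging each box by a small [eta m] makes it open and costs [e / 2 ^
    m.+1] of volume. Finitely many of these boxes cover the compact hull, so
    [g] is bounded at positive integers by the sum over them of the products
    of [(l m i + 2 eta m) k + 1]; compare the coefficients of degree [d + 1]. *)
Lemma volume_cover_ge (a b : nat -> 'rV[R]_d.+1) :
  (forall m i, a m 0 i <= b m 0 i) -> hull V `<=` \bigcup_m box (a m) (b m) ->
  ((g`_d.+1)%:E <= \sum_(0 <= m <oo) (\prod_i (b m 0 i - a m 0 i))%:E)%E.
Proof.
move=> ab cover; apply/lee_addgt0Pr => e e0.
pose l m i := b m 0 i - a m 0 i.
have l0 m i : 0 <= l m i by rewrite subr_ge0.
have pl0 m : 0 <= \prod_i l m i by apply: prodr_ge0.
have e2 m : 0 < e / (2 ^ m.+1)%:R by rewrite divr_gt0// ltr0n expn_gt0.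
apply: (@le_trans _ _ (\sum_(0 <= m <oo) (\prod_i l m i + e / (2 ^
  m.+1)%:R)%:E)%E); last first.
  under eq_eseriesr do rewrite EFinD.
  by apply: (epsilon_trick xpredT); [move=> m; rewrite lee_fin | exact: ltW].
have /choice[eta Heta] : forall m, exists eta, 0 < eta /\
    \prod_i (l m i + eta + eta) <= \prod_i l m i + e / (2 ^ m.+1)%:R.
  by move=> m; have [eta ? ?] := prod_enlarge (l m) (e2 m); exists eta.
pose al m : 'rV[R]_d.+1 := a m - const_mx (eta m).
pose be m : 'rV[R]_d.+1 := b m + const_mx (eta m).
pose O m := [set x : 'rV[R]_d.+1 | forall i, al m 0 i < x 0 i < be m 0 i].
have : cover_compact (hull V) by rewrite -compact_cover; exact: compact_hull.
move=> /(_ nat setT O)[|x /cover[m _ Hm]|D _ PD].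
- by move=> m _; exact: open_box.
- exists m => // i; have /andP[H1 H2] := Hm i; have [em _] := Heta m.
  by rewrite /al /be !mxE ltrBlDr ltr_pwDr// (le_lt_trans H2)// ltrDl.
pose p : {poly R} := \sum_(m <- D) \prod_i ((l m i + eta m + eta m)%:P * 'X +
  1%:P).
have sp : (size p <= d.+2)%N.
  rewrite /p; elim/big_rec: _ => [|m q _ sq]; first by rewrite size_poly0.
  rewrite (leq_trans (size_polyD _ _))// geq_max sq andbT.
  by have [] := coef_prod_linear (fun i => l m i + eta m + eta m) (fun=> 1).
have pd : p`_d.+1 = \sum_(m <- D) \prod_i (l m i + eta m + eta m).
  rewrite coef_sum; apply: eq_bigr => m _.
  by have [] := coef_prod_linear (fun i => l m i + eta m + eta m) (fun=> 1).
apply: le_trans (sum_fset_le_series D _); last first.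
  by move=> m; rewrite addr_ge0// ltW.
rewrite lee_fin; apply: (@le_trans _ _ p`_d.+1); last first.
  by rewrite pd; apply: ler_sum => m _; case: (Heta m).
apply: (le_top_coef (K := 0)) => // k k0; rewrite -ehrhart_g// /nb_int_points.
have fX := finite_int_dilate k0; set X := fset_set _.
have XP x : x \in X -> x \is a mxOver Num.int /\ exists2 y, hull V y & k%:R *:
  y = x.
  by rewrite in_fset_set// in_setE => -[[y Py <-] xi]; split=> //; exists y.
pose Xm m := [fset x in X | `[< O m (k%:R^-1 *: x) >]]%fset.
have cXm m : #|` Xm m| = (\sum_(x <- X | `[< O m (k%:R^-1 *: x) >]) 1)%N.
  by rewrite card_fset_sum1 [RHS]big_fset_condE.
have kR : 0 < k%:R :> R by rewrite ltr0n.
have XX : (#|` X| <= \sum_(m <- D) #|` Xm m|)%N.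
  rewrite card_fset_sum1.
  under [leqRHS]eq_bigr do rewrite cXm.
  rewrite (exchange_big_dep xpredT)//= [leqLHS]big_seq_cond
    [leqRHS]big_seq_cond.
  apply: leq_sum => x /andP[/XP[_ [y /PD[m /= mD Om] yx]] _].
  rewrite sum1_count -has_count; apply/hasP; exists m => //; apply/asboolP.
  by rewrite -yx scalerA mulVf ?lt0r_neq0// scale1r.
apply: (@le_trans _ _ (\sum_(m <- D) #|` Xm m|%:R)).
  by rewrite -natr_sum ler_nat.
rewrite horner_sum; apply: ler_sum => m _.
have [em _] := Heta m.
apply: le_trans (card_int_box (al := fun i => k%:R * al m 0 i) (be := fun i =>
  k%:R * be m 0 i) _ _) _.
- move=> x; rewrite !inE/= => /andP[/XP[xi _] /asboolP Ox]; split=> // i.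
  have /andP[] := Ox i; rewrite !mxE ltr_pdivlMl// ltr_pdivrMl// => H1 H2.
  by apply/andP; split; exact: ltW.
- move=> i; rewrite ler_wpM2l ?ler0n// /al /be !mxE.
  by rewrite lerBlDr -addrA (le_trans (ab m i))// lerDl addr_ge0// ltW.
rewrite horner_prod; apply: ler_prod => i _; rewrite /al /be !mxE !hornerE.
have -> : k%:R * (b m 0 i + eta m) - k%:R * (a m 0 i - eta m) + 1 =
  (l m i + eta m + eta m) * k%:R + 1 by rewrite /l; ring.
have eta0 := ltW em.
rewrite lexx andbT; apply: addr_ge0 => //; apply: mulr_ge0; last exact: ler0n.
by apply: addr_ge0 => //; apply: addr_ge0.
Qed.

End VolumeBounds.

(** * Volume: upper bound by small cubes *)

Section VolumeUpperBound.
Local Open Scope classical_set_scope.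
Variables (R : realType) (n d : nat) (V : 'M[R]_(n, d.+1)) (g : {poly R}).
Hypothesis size_g : (size g <= d.+2)%N.
Hypothesis ehrhart_g : is_ehrhart_poly (hull V) g.
Hypothesis full_V : row_full (row_mx (const_mx 1 : 'cV[R]_n) V).
Hypothesis int_V : V \is a mxOver Num.int.

(** The lower corners of the closed unit cubes of the integer grid that meet
    the dilate by [k]. *)
Definition corners (k : nat) : set 'rV[R]_d.+1 :=
  [set z | z \is a mxOver Num.int /\ exists2 x, hull V x &
     forall i, z 0 i <= k%:R * x 0 i <= z 0 i + 1].

(** The offset [k x - z] is a combination of generators of total weight 0
    whose weights are bounded independently of [k]; adding a large multiple of
    the sum of all generators makes the weights nonnegative. *)
Lemma corners_translate : exists (c : nat) (t : 'rV[R]_d.+1), forall k z,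
  (0 < k)%N -> corners k z ->
  (dilate (k + c) (hull V) `&` @int_points R d.+1) (z + t).
Proof.
have [M MA] := row_fullP full_V.
pose N := (Num.truncn (\sum_i \sum_j `|M i j|)).+1.
exists (N * n)%N, ((const_mx N%:R : 'rV[R]_n) *m V) => k z k0.
move=> [zi [x [u [u0 u1 xE]] zx]]; split; last first.
  apply/mxOverP => i j; rewrite ord1 mxE rpredD ?(mxOverP zi)//.
  rewrite mxE rpred_sum// => l _; rewrite mxE rpredM ?(mxOverP int_V)//.
  exact: natr_int.
pose th : 'rV[R]_d.+1 := k%:R *: x - z.
have th01 i : 0 <= th 0 i <= 1.
  by have := zx i; rewrite !mxE subr_ge0 lerBlDl.
pose ka := row_mx (0 : 'rV[R]_1) th *m M.
have := congr1 (mulmx (row_mx (0 : 'rV[R]_1) th)) MA.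
rewrite mulmx1 mulmxA mul_mx_row => /eq_row_mx[ka1 kaV].
have sum_ka : \sum_j ka 0 j = 0.
  have : (ka *m (const_mx 1 : 'cV[R]_n)) 0 0 = 0 by rewrite ka1 mxE.
  rewrite mxE => E; apply: etrans E.
  by apply: eq_bigr => j _; rewrite [const_mx _ _ _]mxE mulr1.
apply/(dilate_hullP V); first by rewrite addn_gt0 k0.
exists (k%:R *: u + const_mx N%:R - ka); split.
- move=> j; rewrite mxE [X in _ + X]mxE [X in X + _]mxE subr_ge0.
  apply: (@le_trans _ _ N%:R); last first.
    by rewrite [X in _ <= X + _]mxE [X in _ <= _ + X]mxE lerDr mulr_ge0
      ?ler0n// u0.
  apply: le_trans (ltW (truncnS_gt _)).
  rewrite /ka mxE; apply: ler_sum => i _; rewrite (bigD1 j)//=.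
  apply: ler_wpDr; first by rewrite sumr_ge0.
  rewrite (le_trans (ler_norm _))// normrM ler_piMl//.
  rewrite mxE; case: splitP => i' _; first by rewrite mxE normr0.
  by have /andP[H1 H2] := th01 i'; rewrite ger0_norm.
- under eq_bigr do rewrite mxE [X in _ + X]mxE [X in X + _]mxE.
  rewrite sumrB sum_ka subr0 big_split/=.
  under eq_bigr do rewrite mxE; rewrite -mulr_sumr u1 mulr1.
  under eq_bigr do rewrite mxE; rewrite sumr_const card_ord natrD natrM.
  by rewrite mulr_natr.
- by rewrite mulmxBl mulmxDl kaV -scalemxAl -xE /th opprB [RHS]addrC addrA
  subrK.
Qed.

Lemma outer_hull_le : exists c : nat, forall k, (0 < k)%N ->
  (lebesgue_outer (hull V) <= (g.[(k + c)%:R] / k%:R ^+ d.+1)%:E)%E.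
Proof.
have [c [t Ht]] := corners_translate; exists c => k k0.
have kc0 : (0 < k + c)%N by rewrite addn_gt0 k0.
have kR : 0 < k%:R :> R by rewrite ltr0n.
rewrite -ehrhart_g// /nb_int_points.
have fD := finite_int_dilate V kc0.
have fZ : finite_set (corners k).
  apply: (@sub_finite_set _ _ ((fun y => y - t) @` (dilate (k + c) (hull V)
    `&` @int_points R d.+1))).
    by move=> z /(Ht k z k0) H; exists (z + t) => //; rewrite addrK.
  exact: finite_image.
pose s : seq 'rV[R]_d.+1 := fset_set (corners k).
have ss : (size s <= #|` fset_set (dilate (k + c) (hull V) `&` @int_points R
  d.+1)|)%N.
  rewrite -(size_map (fun z => z + t)); apply: uniq_leq_size.
    by rewrite map_inj_uniq ?fset_uniq//; exact: addIr.
  move=> _ /mapP[z zs ->]; rewrite in_fset_set// in_setE; apply: Ht => //.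
  by move: zs; rewrite in_fset_set// in_setE.
pose a m : 'rV[R]_d.+1 := k%:R^-1 *: nth 0 s m.
pose r m : R := if (m < size s)%N then k%:R^-1 else 0.
pose b m : 'rV[R]_d.+1 := a m + const_mx (r m).
have r0 m : 0 <= r m by rewrite /r; case: ifP => // _; rewrite invr_ge0 ler0n.
have lenE m i : b m 0 i - a m 0 i = r m by rewrite /b mxE addrAC subrr add0r
  mxE.
apply: (@le_trans _ _ (\sum_(0 <= m <oo) (\prod_i (b m 0 i - a m 0 i))%:E)%E).
  apply: ereal_inf_lbound; exists a, b; split=> //.
    by move=> m i; rewrite -subr_ge0 lenE.
  move=> x Px; pose z : 'rV[R]_d.+1 := \row_i (Num.floor (k%:R * x 0 i))%:~R.
  have zs : z \in s.
    rewrite in_fset_set// in_setE; split.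
      by apply/mxOverP => i j; rewrite mxE intr_int.
    exists x => // i; rewrite mxE floor_le/=.
    by have := floorD1_gt (k%:R * x 0 i); rewrite intrD => /ltW.
  exists (index z s) => // i; rewrite /b /a nth_index// !mxE /r index_mem zs.
  apply/andP; split; first by rewrite ler_pdivrMl// floor_le.
  rewrite -[X in _ <= _ + X]mulr1 -mulrDr ler_pdivlMl//.
  by have := floorD1_gt (k%:R * x 0 i); rewrite intrD => /ltW.
have pE m : \prod_i (b m 0 i - a m 0 i) = if (m < size s)%N then (k%:R ^+
  d.+1)^-1 else 0.
  under eq_bigr do rewrite lenE; rewrite prodr_const card_ord /r.
  by case: ifP => _; rewrite ?exprVn// expr0n.
apply: lime_le.
  by apply: is_cvg_nneseries => m _ _; rewrite lee_fin prodr_ge0// => i _;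
    rewrite lenE.
apply: nearW => m; rewrite sumEFin lee_fin.
under eq_bigr do rewrite pE.
have c0 : 0 <= (k%:R ^+ d.+1)^-1 :> R by rewrite invr_ge0 exprn_ge0// ler0n.
have -> : \sum_(0 <= i < m) (if (i < size s)%N then (k%:R ^+ d.+1)^-1 else 0) =
    (k%:R ^+ d.+1)^-1 *+ minn m (size s) :> R.
  elim: m => [|m IH]; first by rewrite big_geq// min0n.
  rewrite big_nat_recr//= IH; case: ltnP => ms.
    by rewrite -mulrSr; congr (_ *+ _); lia.
  by rewrite addr0; congr (_ *+ _); lia.
by rewrite -[leLHS]mulr_natl ler_wpM2r// ler_nat (leq_trans (geq_minr _ _)).
Qed.

(** [r k ^ (d + 1) <= g (k + c)] for all positive [k]; compare top
    coefficients after substituting [k - c] for [k]. *)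
Theorem vol_hull : vol (hull V) = g`_d.+1.
Proof.
have [c Hc] := outer_hull_le.
have ge : ((g`_d.+1)%:E <= lebesgue_outer (hull V))%E.
  apply/ereal_infP => _ [a [b [ab cover ->]]].
  exact: (volume_cover_ge size_g ehrhart_g).
rewrite /vol; move: ge Hc; case: (lebesgue_outer _) => [r| |] /=; last first.
- by [].
- by move=> _ /(_ 1%N isT).
rewrite lee_fin => ge Hc; apply/eqP; rewrite eq_le ge andbT.
pose p : {poly R} := r *: ('X - (c%:R)%:P) ^+ d.+1.
have -> : r = p`_d.+1.
  have /monicP := monic_exp d.+1 (monicXsubC (c%:R : R)).
  by rewrite lead_coefE size_exp_XsubC /= coefZ => ->; rewrite mulr1.
apply: (le_top_coef (K := c)) => //.
  by rewrite (leq_trans (size_scale_leq _ _))// size_exp_XsubC.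
move=> k ck; have kc : (0 < k - c)%N by rewrite subn_gt0.
have := Hc _ kc; rewrite subnK 1?ltnW// lee_fin ler_pdivlMr; last first.
  by rewrite exprn_gt0// ltr0n.
by rewrite hornerZ horner_exp hornerXsubC natrB// ltnW.
Qed.

End VolumeUpperBound.

(** * Lattice polytopes as hulls of extreme lattice points *)

Section PolytopeGenerators.
Local Open Scope classical_set_scope.
Variables (R : realType) (d : nat).
Implicit Types (P C : set 'rV[R]_d).

Definition homog (n : nat) (V : 'M[R]_(n, d)) : 'M[R]_(n, 1 + d) :=
  row_mx (const_mx 1 : 'cV[R]_n) V.

Lemma convex_setP C : convex_set C <->
  (forall x y (t : R), 0 <= t <= 1 -> C x -> C y -> C (t *: x + (1 - t) *: y)).
Proof.
split=> [cC x y t /andP[t0 t1] Cx Cy|cC x y t].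
  by have := cC x y (Itv01 t0 t1); rewrite !in_setE; apply.
by rewrite !in_setE => Cx Cy; apply: cC => //; rewrite ge0 le1.
Qed.

Lemma convex_weighted_mean (n : nat) (V : 'M[R]_(n, d)) (u : 'rV[R]_n) C (r :
  seq 'I_n) :
  convex_set C -> nonneg u -> (forall j, j \in r -> C (row j V)) ->
  0 < \sum_(j <- r) u 0 j ->
  C ((\sum_(j <- r) u 0 j)^-1 *: \sum_(j <- r) u 0 j *: row j V).
Proof.
move=> /convex_setP cC u0; elim: r => [|j r IH] Cr; first by rewrite big_nil
  ltxx.
rewrite !big_cons; set S := \sum_(j <- r) u 0 j; set T := \sum_(j <- r) _ *: _
  => S0.
have Cj : C (row j V) by apply: Cr; rewrite mem_head.
have [S1|S1] := eqVneq S 0.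
  have T0 : T = 0.
    rewrite /T big_seq big1// => k kr; have : \sum_(j <- r) u 0 j == 0 by
      apply/eqP.
    rewrite psumr_eq0//; move=> /allP/(_ _ kr)/= /eqP->; exact: scale0r.
  move: S0; rewrite S1 T0 !addr0 => uj.
  by rewrite scalerA mulVf ?scale1r// gt_eqF.
have Sp : 0 < S by rewrite lt0r S1 sumr_ge0.
have -> : (u 0 j + S)^-1 *: (u 0 j *: row j V + T) =
    (u 0 j / (u 0 j + S)) *: row j V + (1 - u 0 j / (u 0 j + S)) *: (S^-1 *: T).
  rewrite scalerDr !scalerA mulrC; congr (_ + _ *: _).
  by field; rewrite S1 gt_eqF.
apply: cC => //; last first.
  by apply: IH => // k kr; apply: Cr; rewrite inE kr orbT.
by rewrite divr_ge0 ?(ltW S0)//= ler_pdivrMr// mul1r lerDl ltW.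
Qed.

Lemma hull_row (n : nat) (V : 'M[R]_(n, d)) j : hull V (row j V).
Proof.
exists (delta_mx 0 j); split; last by rewrite rowE.
  by move=> i; rewrite mxE ler0n.
rewrite (bigD1 j)//= mxE !eqxx big1 ?addr0// => i ij.
by rewrite mxE (negbTE ij) andbF.
Qed.

Lemma sub_hull_convex (n : nat) (V : 'M[R]_(n, d)) C : convex_set C ->
  (forall j, C (row j V)) -> hull V `<=` C.
Proof.
move=> cC CV _ [u [u0 u1 ->]].
have := @convex_weighted_mean n V u C (index_enum _) cC u0 (fun j _ => CV j).
rewrite u1 invr1 scale1r ltr01 => /(_ isT).
suff -> : \sum_(j <- index_enum 'I_n) u 0 j *: row j V = u *m V by [].
by rewrite mulmx_sum_row.
Qed.

Lemma hull_convex (n : nat) (V : 'M[R]_(n, d)) : convex_set (hull V).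
Proof.
apply/convex_setP => x y t /andP[t0 t1] [u [u0 u1 ->]] [v [v0 v1 ->]].
exists (t *: u + (1 - t) *: v); split; last by rewrite mulmxDl -!scalemxAl.
  by move=> j; rewrite !mxE addr_ge0// mulr_ge0// subr_ge0.
under eq_bigr do rewrite !mxE.
by rewrite big_split/= -!mulr_sumr u1 v1; ring.
Qed.

Lemma convex_hullE (n : nat) (V : 'M[R]_(n, d)) (A : set 'rV[R]_d) :
  A = range (fun j => row j V) -> convex_hull A = hull V.
Proof.
move=> ->; apply/seteqP; split.
  by apply: smallest_sub; [exact: hull_convex | move=> _ [j _ <-]; exact:
    hull_row].
move=> x Hx C [cC CV]; apply: (sub_hull_convex cC _ Hx) => j.
by apply: CV; exists j.
Qed.

Lemma homog_mul (n : nat) (V : 'M[R]_(n, d)) (u : 'rV[R]_n) :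
  u *m homog V = row_mx (\sum_j u 0 j)%:M (u *m V).
Proof.
rewrite /homog mul_mx_row; congr row_mx; apply/rowP => i; rewrite !ord1 !mxE
  eqxx mulr1n.
by apply: eq_bigr => j _; rewrite mxE mulr1.
Qed.

Lemma row_homog (n : nat) (V : 'M[R]_(n, d)) j : row j (homog V) = row_mx 1%:M
  (row j V).
Proof.
apply/rowP => i; rewrite !mxE; case: splitP => k _; rewrite !mxE//.
by rewrite ord1 eqxx.
Qed.

Definition extreme_rays (n : nat) (V : 'M[R]_(n, d)) := forall j (u : 'rV[R]_n),
  nonneg u -> u *m homog V = row j (homog V) -> u = delta_mx 0 j.

(** A generating family of least size consists of extreme points: a generator
    that is a nontrivial combination could be dropped. *)
Lemma minimal_generators P : convex_polytope P ->
  exists n (V : 'M[R]_(n, d)), P = hull V /\ extreme_rays V.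
Proof.
have rowsE (n : nat) (V : 'M[R]_(n, d)) (r : seq 'I_n) :
    [set` [seq row j V | j <- r]] = [set row j V | j in [set` r]].
  apply/seteqP; split=> x /=; first by move=> /mapP[j jr ->]; exists j.
  by move=> [j jr <-]; exact: map_f.
move=> [s0 Ps0].
pose gen n := `[< exists V : 'M[R]_(n, d), P = hull V >].
have seq_gen (s : seq 'rV[R]_d) : P = convex_hull [set` s] -> gen (size s).
  move=> Ps; apply/asboolP; exists (\matrix_(j < size s) nth 0 s j).
  rewrite Ps; apply: convex_hullE; apply/seteqP; split=> x /=.
    move=> xs; have xi : (index x s < size s)%N by rewrite index_mem.
    by exists (Ordinal xi) => //; rewrite rowK nth_index.
  by move=> [j _ <-]; rewrite rowK mem_nth.
have ex : exists n, gen n by exists (size s0); exact: seq_gen.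
case: (ex_minnP ex) => n /asboolP[V PV] nmin; exists n, V; split=> // j u u0.
rewrite homog_mul row_homog => /eq_row_mx[/matrixP/(_ 0 0)]; rewrite !mxE eqxx
  !mulr1n => u1 uV.
have [uj|uj] := eqVneq (u 0 j) 1.
  have : \sum_(k | k != j) u 0 k = 0.
    by move: u1; rewrite (bigD1 j)//= uj => /eqP; rewrite addrC -subr_eq0
      addrK => /eqP.
  move=> /eqP; rewrite psumr_eq0// => /allP u00; apply/rowP => k; rewrite mxE
    eqxx/=.
  have [->//|kj] := eqVneq k j.
  by have /implyP/(_ kj)/eqP := u00 k (mem_index_enum _).
pose r := [seq k <- index_enum 'I_n | k != j].
have sr : (size r < n)%N.
  have := count_predC (pred1 j) (index_enum 'I_n).
  rewrite count_uniq_mem ?index_enum_uniq// mem_index_enum -size_filter -/r.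
  by rewrite /index_enum -enumT size_enum_ord; lia.
exfalso; suff : gen (size r) by move=> /nmin; rewrite leqNgt sr.
have -> : size r = size [seq row k V | k <- r] by rewrite size_map.
apply: seq_gen.
set C := convex_hull _.
have cC : convex_set C.
  apply/convex_setP => x y t t01 Cx Cy D [cD sD].
  move/convex_setP : (cD); apply => //; [exact: (Cx D)|exact: (Cy D)].
have Cr k : k != j -> C (row k V).
  move=> kj D [_]; apply; rewrite /=; apply: map_f.
  by rewrite mem_filter kj mem_index_enum.
have Cj : C (row j V).
  have rsum : \sum_(k <- r) u 0 k = 1 - u 0 j.
    by rewrite big_filter -u1 [in RHS](bigD1 j)//= addrAC subrr add0r.
  have uj1 : 0 < 1 - u 0 j.
    rewrite lt0r subr_eq0 eq_sym uj -rsum; exact: sumr_ge0.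
  have rV : \sum_(k <- r) u 0 k *: row k V = (1 - u 0 j) *: row j V.
    rewrite big_filter scalerBl scale1r -{1}uV mulmx_sum_row [in RHS](bigD1
      j)//=.
    by rewrite addrAC subrr add0r.
  have := @convex_weighted_mean n V u C r cC u0 _; rewrite rsum rV => /(_ _
    uj1).
  rewrite scalerA mulVf ?gt_eqF// scale1r; apply=> k.
  by rewrite mem_filter => /andP[/Cr].
rewrite PV; apply/seteqP; split.
  by apply: sub_hull_convex => // k; have [->|/Cr] := eqVneq k j.
apply: smallest_sub; first exact: hull_convex.
by rewrite rowsE => _ [k _ <-]; exact: hull_row.
Qed.

(** A proper convex combination equal to [row j V] has weights concentrated at
    [j], hence so do its two terms. *)
Lemma extreme_rays_vertex n (V : 'M[R]_(n, d)) j : extreme_rays V ->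
  vertex (hull V) (row j V).
Proof.
move=> exV; split; first exact: hull_row.
move=> x y t [u [u0 u1 xE]] [v [v0 v1 yE]] /andP[t0 t1] E.
have w0 : nonneg ((1 - t) *: u + t *: v).
  by move=> k; rewrite !mxE addr_ge0// mulr_ge0// ?subr_ge0 ltW.
have Ew : ((1 - t) *: u + t *: v) *m homog V = row j (homog V).
  rewrite row_homog E mulmxDl -!scalemxAl !homog_mul u1 v1 -xE -yE.
  rewrite !scale_row_mx add_row_mx; congr row_mx.
  by apply/rowP => i; rewrite !mxE; ring.
have /rowP H := exV j _ w0 Ew.
have H0 k : k != j -> u 0 k = 0 /\ v 0 k = 0.
  move=> kj; have := H k; rewrite !mxE (negbTE kj) andbF => /eqP.
  rewrite paddr_eq0 ?mulr_ge0// ?subr_ge0 ?(ltW t0) ?(ltW t1)//.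
  by rewrite !mulf_eq0 subr_eq0 (gt_eqF t1) (gt_eqF t0) /= => /andP[/eqP->
    /eqP->].
have one (z : 'rV[R]_n) : (forall k, k != j -> z 0 k = 0) -> \sum_k z 0 k = 1 ->
    z *m V = row j V.
  move=> z0 z1; rewrite rowE; congr (_ *m _); apply/rowP => k; rewrite mxE
    eqxx/=.
  have [->|/z0//] := eqVneq k j; move: z1; rewrite (bigD1 j)//= big1 ?addr0//
    => i /z0//.
by split; rewrite ?xE ?yE; apply: one => // k /H0[].
Qed.

(** A linear form that vanishes on the homogenized points is an affine
    function that vanishes on the hull, hence on its affine hull, which is the
    whole space. *)
Lemma full_dim_homog n (V : 'M[R]_(n, d)) :
  has_dim (hull V) d -> row_full (homog V).
Proof.
move=> [x0 [L [affE dimL]]].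
have Lfull : L = fullv.
  by apply/eqP; rewrite eqEdim subvf dimvf dim_matrix dimL mul1r leqnn.
have aff x : affine_hull (hull V) x.
  by rewrite affE; exists (x - x0); [rewrite /= Lfull memvf | rewrite addrC
    subrK].
rewrite -cokermx_eq0; apply/eqP/matrixP => i c; rewrite [RHS]mxE.
pose phi := col c (cokermx (homog V)).
have Vphi : homog V *m phi = 0.
  by rewrite /phi colE mulmxA mulmx_coker mul0mx.
pose H := [set x : 'rV[R]_d | (row_mx 1%:M x *m phi) 0 0 = 0].
have HT x : H x.
  apply: aff; split.
    move=> y z t Hy Hz; rewrite /H /=.
    have -> : row_mx 1%:M ((1 - t) *: y + t *: z) =
        (1 - t) *: row_mx (1%:M : 'M[R]_1) y + t *: row_mx 1%:M z.
      rewrite !scale_row_mx add_row_mx -scalerDl subrK scale1r//.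
    by rewrite mulmxDl -!scalemxAl mxE [X in X + _]mxE [X in _ + X]mxE Hy Hz
      !mulr0 addr0.
  move=> y [u [u0 u1 ->]].
  by rewrite /H /= -u1 -homog_mul -mulmxA Vphi mulmx0 mxE.
have HE (x : 'rV[R]_d) : (phi : 'cV[R]_(1 + d)) (lshift d 0) 0 + (x *m (dsubmx
  (phi : 'cV[R]_(1 + d)))) 0 0 = 0.
  have := HT x; rewrite /H /=.
  have -> : row_mx 1%:M x *m phi = usubmx phi + x *m dsubmx phi.
    by rewrite -{1}[phi]vsubmxK mul_row_col mul1mx.
  by rewrite mxE [usubmx phi 0 0]mxE.
have h0 : (phi : 'cV[R]_(1 + d)) (lshift d 0) 0 = 0.
  by have := HE 0; rewrite mul0mx [X in _ + X]mxE addr0.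
have hd j : dsubmx (phi : 'cV[R]_(1 + d)) j 0 = 0.
  by have := HE (delta_mx 0 j); rewrite h0 add0r -rowE mxE.
have -> : cokermx (homog V) i c = phi i 0 by rewrite [RHS]mxE.
rewrite -(splitK i); case: (fintype.split i) => k /=.
  by rewrite ord1 h0.
by have := hd k; rewrite mxE.
Qed.

Lemma card_homog_slice n (V : 'M[R]_(n, d)) k : (0 < k)%N ->
  finite_set (dilate k (hull V) `&` @int_points R d) ->
  #|` lattice_slice (homog V : 'M[R]_(n, d.+1)) k| = nb_int_points (dilate k
    (hull V)).
Proof.
move=> k0 fin.
pose f (y : 'rV[R]_d) : 'rV[R]_(1 + d) := row_mx (k%:R)%:M y.
have finj : injective f by move=> y z /eq_row_mx[].
have A0 j : (homog V : 'M[R]_(n, d.+1)) j 0 = 1.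
  by rewrite mxE; case: splitP => // i _; rewrite mxE.
transitivity #|` (f @` fset_set (dilate k (hull V) `&` @int_points R
  d))%fset|; last first.
  by rewrite card_imfset.
congr #|` _|; apply/fsetP => x; apply/idP/imfsetP => [|[y /=]].
  move=> /(in_slice A0)[[xi [u [u0 xE]]] x0]; exists (rsubmx (x : 'rV[R]_(1 +
    d))).
    rewrite /= in_fset_set// in_setE; split.
      apply/(dilate_hullP V _ k0); exists u; split=> //.
        by rewrite -x0 xE height_mul.
      by rewrite xE homog_mul row_mxKr.
    by apply/mxOverP => i j; rewrite mxE (mxOverP xi).
  have -> : x = row_mx (\sum_j u 0 j)%:M (u *m V) by rewrite xE homog_mul.
  by rewrite row_mxKr /f -x0 xE height_mul.
rewrite in_fset_set// in_setE => -[/(dilate_hullP V _ k0)[u [u0 u1 ->]] yi] ->.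
have E : f (u *m V) = u *m homog V by rewrite homog_mul u1.
apply/(in_slice A0); split; last by rewrite E height_mul.
split; last by exists u.
apply/mxOverP => i j; rewrite mxE; case: splitP => l _; last exact: (mxOverP
  yi).
by rewrite mxE rpredMn// natr_int.
Qed.

End PolytopeGenerators.

(** * The lower bound on the coefficients *)

Local Open Scope classical_set_scope.
Local Open Scope ring_scope.

Theorem theorem1p1 (R : realType) (d : nat) (hd : (3 <= d)%N)
    (P : set 'rV[R]_d) (hP : lattice_polytope P)
    (g : {poly R}) (hg : is_ehrhart_poly P g)
    (i : nat) (hi : (1 <= i <= d.-1)%N) :
  g`_i >= (d`!%:R)^-1 *
          ((-1) ^+ (d - i) * (stirl d.+1 i.+1)%:~R
           + (d`!%:R * vol P - 1) * (Mmin i d)%:~R).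
Proof.
have [polyP dimP vertP] := hP.
have [n [V [PE extV]]] := minimal_generators polyP.
rewrite {P}PE in hP hg polyP dimP vertP *.
have intV : V \is a mxOver Num.int.
  apply/mxOverP => j c.
  have /mxOverP/(_ 0 c) := vertP _ (extreme_rays_vertex j extV).
  by rewrite mxE.
have fullV := full_dim_homog dimP.
case: d hd V extV {hP} hg hi {polyP} dimP vertP intV fullV => // d hd V extV
  hg hi dimP vertP intV fullV.
pose A : 'M[R]_(n, d.+2) := homog V.
have A0 j : A j 0 = 1 by rewrite mxE; case: splitP => // k _; rewrite mxE.
have Aint : A \is a mxOver Num.int.
  apply/mxOverP => j c; rewrite mxE; case: splitP => k _; first by rewrite mxE rpred1.
  exact: (mxOverP intV).
have [w wgen] := exists_generic_cost A.
have [tau [tau0 qgen]] := exists_generic_dir (fullV : row_full A).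
pose h := hstar A w tau.
have gh k : (0 < k)%N ->
    g.[k%:R] = (\sum_(i < d.+2) h i * 'C(k + d.+1 - i, d.+1))%N%:R.
  move=> k0; rewrite -hg// -card_homog_slice//; last exact: finite_int_dilate.
  by rewrite (card_slice A0 Aint wgen tau0 qgen).
have [sg gd] := binomial_basis_top gh.
have volE := vol_hull sg hg fullV intV.
have h1 : h 0%N = 1%N := hstar0 A0 wgen tau0 qgen.
have hle : (h d.+1 <= h 1)%N.
  exact: (hstar_top_le A0 Aint wgen tau0 qgen).
have id : (i <= d.+1)%N by move: hi => /andP[_ /= /leqW].
rewrite (binomial_basis_coef i gh) volE gd ler_wpM2l ?invr_ge0 ?ler0n//.
have := hstar_bound hd id h1 hle; rewrite -(ler_int R); apply: le_trans.
by rewrite rmorphD !rmorphM rmorphB/= rmorphXn/= rmorphN1.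
Qed.
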